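(* Let $n,m\ge1$. The $S(\mathfrak{gl}_n^* )^{\mathfrak{gl}_n}$-algebra $\mathscr{B}(m\varpi_1)$ is isomorphic to $$\mathbb{C}[t_1,\dots,t_n]^{\mathfrak{S}_n}[u_1,\dots,u_m]^{\mathfrak{S}_m}/J,$$ where $\mathfrak{S}_m$ permutes $u_1,\dots,u_m$, $J$ is the ideal of $\mathbb{C}[t_1,\dots,t_n]^{\mathfrak{S}_n}[u_1,\dots,u_m]^{\mathfrak{S}_m}$ given by $$J=\bigl\langle f_1+\dots+f_m,\ u_1f_1+\dots+u_mf_m,\ \dots,\ u_1^{m-1}f_1+\dots+u_m^{m-1}f_m\bigr\rangle,$$ and $f_i=(u_i-t_1)\cdots(u_i-t_n)$ for each $i=1,\dots,m$.
   Context: $\mathfrak{gl}_n$ (complex $n\times n$ matrices) has matrix units $E_{ij}$ and coordinates $y_{ij}$; $c_k(Y)$ is the sum of the principal $k\times k$ minors of $Y$ ($c_0=1$). Restriction to diagonal matrices $\mathrm{diag}(t_1,\dots,t_n)$ identifies $S(\mathfrak{gl}_n^* )^{\mathfrak{gl}_n}$ with $\mathbb{C}[t_1,\dots,t_n]^{\mathfrak{S}_n}$. $V=V(m\varpi_1)=S^m(\mathbb{C}^n)$ is the irreducible $\mathrm{GL}_n$-representation of highest weight $m\varpi_1$ ($\varpi_1$ the first fundamental weight), with $\pi:\mathfrak{gl}_n\to\mathrm{End}\,V$. The Kirillov algebra $\mathscr{C}(V)$ is the algebra of $\mathrm{GL}_n$-equivariant polynomial maps $\mathfrak{gl}_n\to\mathrm{End}\,V$;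 it is an $S(\mathfrak{gl}_n^* )^{\mathfrak{gl}_n}$-algebra with $c$ identified with $Y\mapsto c(Y)\,\mathrm{Id}_V$. The Kirillov--Wei operator is $(\mathbf{D}F)(Y)=\sum_{i,j=1}^n\frac{\partial F}{\partial y_{ji}}(Y)\cdot\pi(E_{ij})$. The big algebra $\mathscr{B}(m\varpi_1)$ is the subalgebra of $\mathscr{C}(V)$ generated by $\mathbf{D}^q(c_{p+q})$ for $p,q\ge0$, $p+q\le n$. *)

(* Defs.v *)
From HB Require Import structures.
From mathcomp Require Import all_boot all_order all_fingroup all_algebra.
From mathcomp Require Import ring.
From mathcomp Require Import boolp.
From mathcomp Require Import mpoly.
Set Implicit Arguments.
Unset Strict Implicit.
Unset Printing Implicit Defensive.
Import GRing.Theory Num.Theory.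
Local Open Scope ring_scope.

(* S(gl_n^* ) is {mpoly C[n * n]}, the coordinate y_ij being the variable of
   index mxvec_index i j. *)
Section GlPolynomials.
Variables (C : numClosedFieldType) (n : nat).
Implicit Types (c : {mpoly C[n * n]}) (X Y : 'M[C]_n).

Definition ycoord (i j : 'I_n) : {mpoly C[n * n]} := 'X_(mxvec_index i j).

Definition ymx : 'M[{mpoly C[n * n]}]_n := \matrix_(i, j) ycoord i j.

Definition yderiv (i j : 'I_n) c : {mpoly C[n * n]} := c^`M(mxvec_index i j).

Definition glpoly_eval Y c : C := c.@[fun k => mxvec Y 0 k].

HB.instance Definition _ Y :=
  GRing.RMorphism.copy (glpoly_eval Y) (meval (fun k => mxvec Y 0 k)).

(* The action of X \in gl_n on S(gl_n^* ) as a derivation: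
   (X . c)(Y) = d/ds c(e^(-sX) Y e^(sX)) at s = 0. *)
Definition gl_act X c : {mpoly C[n * n]} :=
  \sum_i \sum_j
    yderiv i j c
    * (ymx *m map_mx (@mpolyC _ _) X - map_mx (@mpolyC _ _) X *m ymx) i j.

Definition gl_invariant c : Prop := forall X, gl_act X c = 0.

Definition cpoly (k : nat) : {mpoly C[n * n]} :=
  \sum_(A : {set 'I_n} | #|A| == k)
    \det (mxsub (@enum_val _ (mem A)) (@enum_val _ (mem A)) ymx).

Definition diag_restrict c : {mpoly C[n]} :=
  c \mPo [tuple mxvec (diag_mx (\row_(i < n) 'X_i)) 0 k | k < n * n].

End GlPolynomials.

Lemma mmap_chain (N : nat) (A : nzRingType) (S : comNzRingType) (D : {additive S -> S})
    (f : {rmorphism A -> S}) (h : 'I_N -> S) (p : {mpoly A[N]}) :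
    (forall x y, D (x * y) = D x * y + x * D y) -> (forall a, D (f a) = 0) ->
  D (mmap f h p) = \sum_k mmap f h p^`M(k) * D (h k).
Proof.
move=> DM Df; pose P q := D (mmap f h q) = \sum_k mmap f h q^`M(k) * D (h k).
have PM q r : P q -> P r -> P (q * r).
  rewrite /P rmorphM DM => -> ->; rewrite mulr_suml mulr_sumr -big_split /=.
  by apply: eq_bigr => k _; rewrite mderivM rmorphD !rmorphM /=; ring.
have PD q r : P q -> P r -> P (q + r).
  rewrite /P !raddfD => -> ->; rewrite -big_split /=.
  by apply: eq_bigr => k _; rewrite raddfD /= raddfD mulrDl.
have PC a : P a%:MP.
  by rewrite /P mmapC Df big1 // => k _; rewrite mderivC raddf0 mul0r.
have PX i : P 'X_i.
  rewrite /P mmapX mmap1U (bigD1 i) //= big1 => [|k neq_ki].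
    rewrite mderivX mnm1E eqxx scale1r (_ : (U_(i) - U_(i))%MM = 0%MM).
      by rewrite mpolyX0 rmorph1 mul1r addr0.
    by apply/mnmP=> j; rewrite mnmBE subnn mnm0E.
  by rewrite mderivX mnm1E eq_sym (negPf neq_ki) scale0r raddf0 mul0r.
rewrite -/(P p); elim/mpolyind: p => [|a m p _ _ IH]; first exact: PC 0.
apply: PD => //; rewrite -mul_mpolyC; apply: (PM) => //; rewrite mpolyXE_id.
apply: (big_ind P) => [|q r|i _]; [exact: (PC 1) | exact: PM |].
by elim: (m i) => [|e IHe]; [exact: (PC 1) | rewrite exprS; exact: PM].
Qed.

Lemma rmorph_mmap (N : nat) (A S T : nzRingType) (g : {rmorphism S -> T})
    (f : A -> S) (h : 'I_N -> S) (p : {mpoly A[N]}) :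
  g (mmap f h p) = mmap (g \o f) (g \o h) p.
Proof.
rewrite /mmap rmorph_sum; apply: eq_bigr => a _; rewrite rmorphM rmorph_prod /=.
by congr (_ * _); apply: eq_bigr => k _; rewrite rmorphXn.
Qed.

Lemma eq_mmap (N : nat) (A S : nzRingType) (f f' : A -> S) (h h' : 'I_N -> S)
    (p : {mpoly A[N]}) :
  f =1 f' -> h =1 h' -> mmap f h p = mmap f' h' p.
Proof.
move=> eq_f eq_h; apply: eq_bigr => a _; rewrite eq_f; congr (_ * _).
by apply: mmap1_eq.
Qed.

Lemma mpoly_deriv0 (C : numClosedFieldType) n (q : {poly {mpoly C[n]}}) :
  q^`() = 0 -> q = (q`_0)%:P.
Proof.
move=> q'0; apply/polyP => -[|i]; rewrite coefC //=; apply/mpolyP => m.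
have := congr1 (fun r : {poly _} => (r`_i)@_m) q'0.
by rewrite coef_deriv coef0 mcoeff0 mcoeffMn => /eqP; rewrite mulrn_eq0 => /eqP.
Qed.

Section Unipotent.
Variables (K : comNzRingType) (n : nat) (P A : 'M[K]_n).
Hypothesis PP0 : P *m P = 0.

Definition unip_path : 'M[{poly K}]_n :=
  (1%:M + 'X *: map_mx polyC P) *m map_mx polyC A *m (1%:M - 'X *: map_mx polyC P).

Lemma unip_pathE : unip_path =
  map_mx polyC A + 'X *: map_mx polyC (P *m A - A *m P)
  - 'X ^+ 2 *: map_mx polyC (P *m A *m P).
Proof.
rewrite /unip_path map_mxB !map_mxM mulmxBr mulmx1 mulmxDl mul1mx mulmxDl.
by rewrite -!scalemxAr -!scalemxAl scalerA -expr2 scalerBr opprD !addrA.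
Qed.

Lemma deriv_unip_path :
  map_mx (@deriv K) unip_path
  = map_mx polyC P *m unip_path - unip_path *m map_mx polyC P.
Proof.
transitivity (map_mx polyC (P *m A - A *m P) - 'X *+ 2 *: map_mx polyC (P *m A *m P)).
  rewrite unip_pathE; move: (P *m A - A *m P) (P *m A *m P) => B D.
  apply/matrixP => i j; rewrite !mxE derivB derivD derivC !derivM derivX !derivC.
  by rewrite !mulr0 !addr0 ?mul1r ?mulr1 ?add0r -?mulr2n.
have PB : P *m (P *m A - A *m P) = - (P *m A *m P).
  by rewrite mulmxBr !mulmxA PP0 mul0mx sub0r.
have BP : (P *m A - A *m P) *m P = P *m A *m P.
  by rewrite mulmxBl -(mulmxA A P P) PP0 mulmx0 subr0.
have PD : P *m (P *m A *m P) = 0 by rewrite !mulmxA PP0 !mul0mx.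
have DP : P *m A *m P *m P = 0 by rewrite -(mulmxA _ P P) PP0 mulmx0.
rewrite unip_pathE mulmxBr mulmxDr mulmxBl mulmxDl -!scalemxAr -!scalemxAl.
rewrite -!map_mxM PB BP PD DP !map_mx0 !scaler0 !subr0 map_mxN scalerN mulr2n scalerDl.
by rewrite map_mxB !opprD !addrA; congr (_ - _); rewrite addrAC.
Qed.

Lemma unip_path_eval s :
  map_mx (horner_eval s) unip_path = (1%:M + s *: P) *m A *m (1%:M - s *: P).
Proof.
have hP (B : 'M[K]_n) : map_mx (horner_eval s) (map_mx polyC B) = B.
  by apply/matrixP => i j; rewrite !mxE /horner_eval hornerC.
by rewrite /unip_path !map_mxM map_mxB map_mxD !map_mxZ !map_mx1 !hP /= /horner_eval hornerX.
Qed.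

End Unipotent.

Section DiagRestrict.
Variables (C : numClosedFieldType) (n : nat) (c : {mpoly C[n * n]}).
Hypothesis c_inv : gl_invariant c.
Notation K := {mpoly C[n]}.

Definition mpoly_mxeval (S : nzRingType) (f : C -> S) (A : 'M[S]_n) : S :=
  mmap f (fun k => mxvec A 0 k) c.

Lemma gl_invariant_mxeval (S : comNzRingType) (f : {rmorphism C -> S}) (X : 'M[C]_n)
    (Z : 'M[S]_n) :
  \sum_i \sum_j mmap f (fun k => mxvec Z 0 k) (yderiv i j c) *
    (map_mx f X *m Z - Z *m map_mx f X) i j = 0.
Proof.
pose g : {rmorphism {mpoly C[n * n]} -> S} := mmap f (fun k => mxvec Z 0 k).
have gY : map_mx g (@ymx C n) = Z.
  by apply/matrixP => i j; rewrite !mxE [LHS]mmapX mmap1U mxvecE.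
have gX : map_mx g (map_mx (@mpolyC (n * n) C) X) = map_mx f X.
  by apply/matrixP => i j; rewrite !mxE [LHS]mmapC.
have E : g (gl_act X c) = 0 by rewrite c_inv rmorph0.
apply: oppr_inj; rewrite oppr0 -[RHS]E [RHS]raddf_sum -sumrN.
apply: eq_bigr => i _; rewrite [RHS]raddf_sum -sumrN; apply: eq_bigr => j _.
rewrite [RHS]rmorphM -mulrN; congr (_ * _).
have -> : forall B : 'M_n, g (B i j) = map_mx g B i j by move=> B; rewrite mxE.
by rewrite map_mxB !map_mxM gY gX !mxE opprB.
Qed.

Lemma mxeval_unip (X : 'M[C]_n) (A : 'M[K]_n) : X *m X = 0 ->
  let XK := map_mx (@mpolyC n C) X in
  mpoly_mxeval (@mpolyC n C) ((1%:M + XK) *m A *m (1%:M - XK))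
  = mpoly_mxeval (@mpolyC n C) A.
Proof.
move=> XX0 XK; have XK0 : XK *m XK = 0 by rewrite -map_mxM XX0 map_mx0.
pose f : {rmorphism C -> {poly K}} := polyC \o @mpolyC n C.
pose q := mpoly_mxeval f (unip_path XK A).
have q'0 : q^`() = 0.
  rewrite /q /mpoly_mxeval (@mmap_chain _ _ _ (@deriv K)); first last.
  - by move=> a; rewrite /= derivC.
  - exact: derivM.
  rewrite -[RHS](gl_invariant_mxeval f X (unip_path XK A)).
  have -> : map_mx f X = map_mx polyC XK by apply/matrixP => i j; rewrite !mxE.
  rewrite -deriv_unip_path // (reindex _ (curry_mxvec_bij n n)) /=.
  rewrite pair_bigA; apply: eq_bigr => -[i j] _ /=.
  by rewrite mxvecE [RHS]mulrC [in RHS]mxE mulrC.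
have qE s : q.[s] = mpoly_mxeval (@mpolyC n C) ((1%:M + s *: XK) *m A *m (1%:M - s *: XK)).
  rewrite -unip_path_eval -[LHS]/(horner_eval s q) /q /mpoly_mxeval.
  rewrite (@rmorph_mmap _ _ _ _ (horner_eval s)); apply: eq_mmap => [a|k].
    by rewrite /= /horner_eval hornerC.
  by rewrite -map_mxvec mxE.
transitivity q.[1]; first by rewrite qE scale1r.
have -> : q.[1] = q.[0] by rewrite (mpoly_deriv0 q'0) !hornerC.
rewrite qE.
by rewrite !scale0r addr0 subr0 mul1mx mulmx1.
Qed.

Lemma mxeval_diag_tperm (d : 'rV[K]_n) (i j : 'I_n) :
  mpoly_mxeval (@mpolyC n C) (diag_mx (\row_k d 0 (tperm i j k)))
  = mpoly_mxeval (@mpolyC n C) (diag_mx d).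
Proof.
have [->|neq_ij] := eqVneq i j.
  by congr (mpoly_mxeval _ (diag_mx _)); apply/rowP => k; rewrite mxE tperm1 perm1.
set d' := \row_k _.
pose E k l : 'M[K]_n := delta_mx k l.
have neq_ji : j != i by rewrite eq_sym.
have EE k l l' k' : E k l *m E l' k' = E k k' *+ (l == l') by exact: mul_delta_mx_cond.
have unip k l (A : 'M[K]_n) : k != l ->
    mpoly_mxeval (@mpolyC n C) ((1%:M + E k l) *m A *m (1%:M - E k l))
      = mpoly_mxeval (@mpolyC n C) A
    /\ mpoly_mxeval (@mpolyC n C) ((1%:M - E k l) *m A *m (1%:M + E k l))
      = mpoly_mxeval (@mpolyC n C) A.
  move=> neq_kl; have d0 : (delta_mx k l : 'M[C]_n) *m delta_mx k l = 0.
    by rewrite mul_delta_mx_cond eq_sym (negPf neq_kl).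
  have Ed : map_mx (@mpolyC n C) (delta_mx k l) = E k l by rewrite map_delta_mx.
  split; first by rewrite -(mxeval_unip A d0) Ed.
  have d0' : (- delta_mx k l : 'M[C]_n) *m (- delta_mx k l) = 0.
    by rewrite mulmxN mulNmx opprK.
  by rewrite -[RHS](mxeval_unip A d0') map_mxN Ed opprK.
pose g := (1%:M + E i j) *m (1%:M - E j i) *m (1%:M + E i j).
pose h := (1%:M - E i j) *m (1%:M + E j i) *m (1%:M - E i j).
have gE : g = 1%:M + E i j - E j i - E i i - E j j.
  have g1 : (1%:M + E i j) *m (1%:M - E j i) = 1%:M + E i j - E j i - E i i.
    by rewrite mulmxBr mulmx1 mulmxDl mul1mx EE eqxx mulr1n opprD addrA.
  have ge : (1%:M + E i j - E j i - E i i) *m E i j = - E j j.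
    rewrite mulmxBl mulmxBl mulmxDl mul1mx !EE !eqxx (negPf neq_ji) mulr0n !mulr1n addr0.
    by rewrite addrAC subrr sub0r.
  by rewrite /g g1 mulmxDr mulmx1 ge.
have inv2 k l : k != l -> (1%:M + E k l) *m (1%:M - E k l) = 1%:M.
  move=> neq_kl; rewrite mulmxDl mul1mx mulmxBr mulmx1 EE eq_sym (negPf neq_kl) mulr0n.
  by rewrite subr0 subrK.
have inv2' k l : k != l -> (1%:M - E k l) *m (1%:M + E k l) = 1%:M.
  move=> neq_kl; rewrite mulmxBl mul1mx mulmxDr mulmx1 EE eq_sym (negPf neq_kl) mulr0n.
  by rewrite addr0 addrK.
have gh : g *m h = 1%:M.
  rewrite /g /h !mulmxA -(mulmxA _ (1%:M + E i j)) inv2 // mulmx1.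
  by rewrite -(mulmxA _ (1%:M - E j i)) inv2' // mulmx1 inv2.
have gd : g *m diag_mx d = diag_mx d' *m g.
  rewrite mul_mx_diag mul_diag_mx gE; apply/matrixP => a b; rewrite !mxE.
  have [->|neq_aj] := eqVneq a j; rewrite ?tpermR ?(negPf neq_ji) /=.
    have [->|neq_bj] := eqVneq b j; rewrite ?eqxx ?(negPf neq_ji) /=; first by ring.
    by have [->|neq_bi] := eqVneq b i; rewrite ?eqxx /=; ring.
  have [->|neq_ai] := eqVneq a i; rewrite ?tpermL ?eqxx /=.
    have [->|neq_bi] := eqVneq b i; rewrite ?eqxx ?(negPf neq_ij) /=; first by ring.
    by have [->|neq_bj] := eqVneq b j; rewrite ?eqxx /=; ring.
  rewrite tpermD 1?eq_sym //.
  by have [->|neq_ab] := eqVneq a b; rewrite /=; ring.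
have -> : diag_mx d' = g *m diag_mx d *m h by rewrite gd -mulmxA gh mulmx1.
rewrite /g /h -!mulmxA !mulmxA.
have -> (P Q A : 'M[K]_n) P' Q' : P *m Q *m P *m A *m P' *m Q' *m P'
  = P *m (Q *m (P *m A *m P') *m Q') *m P' by rewrite !mulmxA.
by rewrite (proj1 (unip _ _ _ neq_ij)) (proj2 (unip _ _ _ neq_ji)) (proj1 (unip _ _ _ neq_ij)).
Qed.

Lemma msym_diag_restrict (s : 'S_n) : msym s (diag_restrict c) = diag_restrict c.
Proof.
have evE (d : 'rV[K]_n) s' : mpoly_mxeval (@mpolyC n C) (diag_mx (\row_k d 0 ((s' : 'S_n) k)))
    = mpoly_mxeval (@mpolyC n C) (diag_mx d).
  have [ts -> _] := prod_tpermP s'; elim: ts d => [|t ts IH] d.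
    rewrite big_nil; congr (mpoly_mxeval _ (diag_mx _)).
    by apply/rowP => k; rewrite mxE perm1.
  rewrite big_cons -[RHS](IH d) -[RHS](mxeval_diag_tperm _ t.1 t.2).
  congr (mpoly_mxeval _ (diag_mx _)); apply/rowP => k.
  by rewrite !mxE permM.
pose x : 'rV[K]_n := \row_k 'X_k.
have -> : diag_restrict c = mpoly_mxeval (@mpolyC n C) (diag_mx x).
  by rewrite /diag_restrict /comp_mpoly; apply: eq_mmap => // k; rewrite tnth_mktuple.
rewrite -[RHS](evE x s) /mpoly_mxeval (@rmorph_mmap _ _ _ _ (msym s)).
apply: eq_mmap => [a|k]; first by rewrite /= /msym mmapC.
rewrite /=; case/mxvec_indexP: k => a b; rewrite !mxvecE !mxE.
by rewrite raddfMn /= /msym mmapX mmap1U.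
Qed.

End DiagRestrict.

(* S^m(C^n) is the space of homogeneous polynomials of degree m in
   x_1, ..., x_n, where x_i stands for the i-th vector of the standard basis;
   End S^m(C^n) is the algebra of matrices in the basis of monomials, acting
   on column vectors, so that *m is composition. A polynomial map from gl_n to
   End S^m(C^n) is then a matrix with entries in S(gl_n^* ). *)
Section SymmetricPower.
Variables (C : numClosedFieldType) (n m : nat).
Implicit Types (g X : 'M[C]_n) (p : {mpoly C[n]}).

Definition symbasis := {a : 'X_{1..n < m.+1} | mdeg a == m}.

Definition symdim : nat := #|{: symbasis}|.

Definition symmon (a : 'I_symdim) : 'X_{1..n} := val (val (enum_val a)).

Definition symmx (f : {mpoly C[n]} -> {mpoly C[n]}) : 'M[C]_symdim :=
  \matrix_(a, b) (f 'X_[symmon b])@_(symmon a).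

(* S^m(g): the algebra endomorphism x_j |-> g x_j = \sum_i g_ij x_i *)
Definition subst_mx g p : {mpoly C[n]} :=
  p \mPo [tuple \sum_(i < n) g i j *: 'X_i | j < n].

(* its differential: the derivation x_j |-> X x_j *)
Definition der_mx X p : {mpoly C[n]} :=
  \sum_(i < n) \sum_(j < n) X i j *: ('X_i * p^`M(j)).

Definition rho g : 'M[C]_symdim := symmx (subst_mx g).

Definition dpi X : 'M[C]_symdim := symmx (der_mx X).

Lemma symmx_mul (f : {linear {mpoly C[n]} -> {mpoly C[n]}}) f' :
    (forall b, f' 'X_[symmon b] \is m.-homog) ->
  symmx f *m symmx f' = symmx (f \o f').
Proof.
move=> f'_homog; apply/matrixP => a b; rewrite !mxE /=; set p := f' _.
have -> : f p = \sum_k p@_(symmon k) *: f 'X_[symmon k].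
  have {1}-> : p = \sum_k p@_(symmon k) *: 'X_[symmon k].
    apply/mpolyP => e; rewrite raddf_sum /=.
    have [deg_e|deg_e] := eqVneq (mdeg e) m; last first.
      rewrite (dhomog_nemf_coeff (f'_homog b) deg_e) big1 // => k _.
      rewrite mcoeffZ mcoeffX; case: eqP => [eq_e|_]; last by rewrite mulr0.
      by case/negP: deg_e; rewrite -eq_e; exact: (valP (enum_val k)).
    have lt_e : (mdeg e < m.+1)%N by rewrite deg_e.
    have deg_e' : mdeg (BMultinom lt_e) == m by rewrite /= deg_e.
    pose e' : symbasis := Sub (BMultinom lt_e) deg_e'.
    have symE : symmon (enum_rank e') = e by rewrite /symmon enum_rankK.
    rewrite (bigD1 (enum_rank e')) //= symE mcoeffZ mcoeffX eqxx mulr1 big1 ?addr0 // => k neq_k.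
    rewrite mcoeffZ mcoeffX; case: (symmon k =P e) => [eq_e|_]; last by rewrite mulr0.
    case/eqP: neq_k; apply: enum_val_inj; rewrite enum_rankK; apply/val_inj/val_inj.
    by rewrite /= -eq_e.
  rewrite linear_sum; apply: eq_bigr => k _; exact: linearZ.
rewrite raddf_sum; apply: eq_bigr => k _.
by rewrite /= !mxE mcoeffZ mulrC.
Qed.

Lemma subst_mx_homog g a : mdeg a = m -> subst_mx g 'X_[a] \is m.-homog.
Proof.
move=> <-; rewrite /subst_mx comp_mpolyX mdegE.
elim/big_rec2: _ => [|j d q _ IH]; first exact: dhomog1.
apply: dhomogM => //; rewrite -[X in X.-homog]mul1n; apply: dhomogMn.
rewrite tnth_mktuple rpred_sum // => i _; apply: rpredZ.
by rewrite dhomogX; apply/eqP/mdeg1.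
Qed.

Lemma rho_mul g h : rho (g *m h) = rho g *m rho h.
Proof.
rewrite /rho symmx_mul; last first.
  by move=> b; apply: subst_mx_homog; exact/eqP/(valP (enum_val b)).
apply/matrixP => a b; rewrite !mxE /= /subst_mx; congr (_@__).
rewrite !comp_mpolyX rmorph_prod; apply: eq_bigr => j _.
rewrite rmorphXn; congr (_ ^+ _); rewrite !tnth_mktuple raddf_sum /=.
under eq_bigr do rewrite mxE scaler_suml.
rewrite exchange_big; apply: eq_bigr => k _.
rewrite linearZ /= comp_mpolyXU -tnth_nth tnth_mktuple scaler_sumr.
by apply: eq_bigr => i _; rewrite scalerA mulrC.
Qed.

Lemma rho1 : rho 1%:M = 1%:M.
Proof.
apply/matrixP => a b; rewrite !mxE /subst_mx.
have -> : 'X_[symmon b] \mPo [tuple \sum_i (1%:M : 'M[C]_n) i j *: 'X_i | j < n]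
    = 'X_[symmon b].
  rewrite -[RHS]comp_mpoly_id; congr (_ \mPo _); apply: eq_mktuple => j.
  rewrite (bigD1 j) //= mxE eqxx scale1r big1 ?addr0 // => i neq_ij.
  by rewrite mxE (negPf neq_ij) scale0r.
rewrite mcoeffX (_ : (_ == _) = (a == b)) //; apply/eqP/eqP => [eq_ab|-> //].
by apply: enum_val_inj; apply/val_inj/val_inj.
Qed.

End SymmetricPower.

Section KirillovAlgebra.
Variables (C : numClosedFieldType) (n m : nat).

Local Notation polymap := 'M[{mpoly C[n * n]}]_(symdim n m).
Implicit Types (F : polymap).

Definition polymap_eval (Y : 'M[C]_n) F : 'M[C]_(symdim n m) :=
  map_mx (glpoly_eval Y) F.

Definition GL_equivariant F : Prop :=
  forall g Y, g \in unitmx ->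
    polymap_eval (g *m Y *m invmx g) F
    = rho m g *m polymap_eval Y F *m rho m (invmx g).

Definition kirillov_wei F : polymap :=
  \sum_i \sum_j
    map_mx (@yderiv C n j i) F *m map_mx (@mpolyC _ _) (dpi m (delta_mx i j)).

Definition kirillov_pred : {pred polymap} := fun F => asbool (GL_equivariant F).

Lemma kirillov_subring : subring_closed kirillov_pred.
Proof.
have inv g : g \in unitmx -> rho m g *m rho m (invmx g) = 1%:M.
  by move=> g_unit; rewrite -rho_mul mulmxV // rho1.
have inv' g : g \in unitmx -> rho m (invmx g) *m rho m g = 1%:M.
  by move=> g_unit; rewrite -rho_mul mulVmx // rho1.
split=> [|F G /asboolP F_eq /asboolP G_eq|F G /asboolP F_eq /asboolP G_eq];
  apply/asboolP => g Y g_unit.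
- by rewrite -[1]/(1%:M : 'M_(symdim n m)) /polymap_eval !map_mx1 mulmx1 inv.
- rewrite /polymap_eval !map_mxB -!/(polymap_eval _ _) F_eq // G_eq //.
  by rewrite mulmxBr mulmxBl.
- rewrite -[F * G]/(F *m G) /polymap_eval !map_mxM -!/(polymap_eval _ _) F_eq // G_eq //.
  by rewrite !mulmxA -(mulmxA _ _ (rho m g)) inv' // mulmx1.
Qed.

Record kirillov := Kirillov {
  kirillov_map : polymap; kirillovP : kirillov_map \in kirillov_pred }.

HB.instance Definition _ := [isSub for kirillov_map].
HB.instance Definition _ := [Choice of kirillov by <:].
HB.instance Definition _ := GRing.SubChoice_isSubPzRing.Build _ _ kirillov kirillov_subring.

(* BigConst makes this the C-subalgebra generated by the D^q(c_(p+q)): all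
   scalars are included, but not a priori all of S(gl_n^* )^gl_n. *)
Inductive big_generated : kirillov -> Prop :=
| BigConst (a : C) (F : kirillov) :
    kirillov_map F = a%:MP%:M -> big_generated F
| BigGen (p q : nat) (F : kirillov) :
    (p + q <= n)%N ->
    kirillov_map F = iter q kirillov_wei (cpoly C n (p + q))%:M ->
    big_generated F
| BigAdd (F G : kirillov) :
    big_generated F -> big_generated G -> big_generated (F + G)
| BigMul (F G : kirillov) :
    big_generated F -> big_generated G -> big_generated (F * G).

Definition big_pred : {pred kirillov} := fun F : kirillov => asbool (big_generated F).

Lemma big_subring : subring_closed big_pred.
Proof.
have gen1 a : a%:MP%:M \in kirillov_pred.
  apply/asboolP => g Y g_unit; rewrite /polymap_eval !map_scalar_mx /= /glpoly_eval.
  by rewrite mul_mx_scalar -scalemxAl -rho_mul mulmxV // rho1 scalemx1 !mevalC.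
have big_const a : big_generated (Kirillov (gen1 a)) by apply: BigConst.
split=> [|F G /asboolP F_big /asboolP G_big|F G /asboolP F_big /asboolP G_big];
  apply/asboolP.
- by apply: (BigConst (a := 1)); rewrite mpolyC1.
- suff -> : F - G = F + Kirillov (gen1 (-1)) * G by apply/BigAdd/BigMul.
  by congr (_ + _); apply: val_inj; rewrite /= mpolyCN mpolyC1 [RHS]mul_scalar_mx scaleN1r.
- exact: BigMul.
Qed.

Record big_algebra := BigAlgebra {
  big_kirillov : kirillov; big_algebraP : big_kirillov \in big_pred }.

HB.instance Definition _ := [isSub for big_kirillov].
HB.instance Definition _ := [Choice of big_algebra by <:].
HB.instance Definition _ := GRing.SubChoice_isSubPzRing.Build _ _ big_algebra big_subring.

End KirillovAlgebra.

Section Presentation.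
Variables (C : numClosedFieldType) (n : nat).

Definition glinv_pred : {pred {mpoly C[n * n]}} := fun c => asbool (gl_invariant c).

Lemma gl_act_is_linear (X : 'M[C]_n) : linear (gl_act X).
Proof.
move=> a c d; rewrite /gl_act scaler_sumr -big_split; apply: eq_bigr => i _.
rewrite scaler_sumr -big_split; apply: eq_bigr => j _ /=.
by rewrite /yderiv linearP /= mulrDl scalerAl.
Qed.

Lemma gl_actM (X : 'M[C]_n) c d : gl_act X (c * d) = gl_act X c * d + c * gl_act X d.
Proof.
rewrite /gl_act mulr_suml mulr_sumr -big_split; apply: eq_bigr => i _.
rewrite mulr_suml mulr_sumr -big_split; apply: eq_bigr => j _ /=.
by rewrite /yderiv mderivM; ring.
Qed.

Lemma glinv_subring : subring_closed glinv_pred.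
Proof.
split=> [|c d /asboolP c_inv /asboolP d_inv|c d /asboolP c_inv /asboolP d_inv];
  apply/asboolP => X.
- rewrite /gl_act big1 // => i _; rewrite big1 // => j _.
  by rewrite /yderiv -mpolyC1 mderivC mul0r.
- have -> : c - d = -1 *: d + c by rewrite scaleN1r addrC.
  by rewrite gl_act_is_linear c_inv d_inv scaler0 addr0.
- by rewrite gl_actM c_inv d_inv mul0r mulr0 addr0.
Qed.

Record glinv := GlInv {
  glinv_poly : {mpoly C[n * n]}; glinvP : glinv_poly \in glinv_pred }.

HB.instance Definition _ := [isSub for glinv_poly].
HB.instance Definition _ := [Choice of glinv by <:].
HB.instance Definition _ := GRing.SubChoice_isSubComNzRing.Build _ _ glinv glinv_subring.

Variable m : nat.

(* C[t_1, ..., t_n]^S_n [u_1, ..., u_m]^S_m, inside C[t][u] *)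
Definition tupoly_pred : {pred {mpoly {mpoly C[n]}[m]}} :=
  fun p => (p \is a mpolyOver m (@symmetric_pred n C)) && (p \is symmetric).

Lemma tupoly_subring : subring_closed tupoly_pred.
Proof.
split=> [|p q /andP[pt pu] /andP[qt qu]|p q /andP[pt pu] /andP[qt qu]];
  apply/andP; split; by [exact: rpred1 | exact: rpredB | exact: rpredM].
Qed.

Record tupoly := TUPoly {
  tupoly_poly : {mpoly {mpoly C[n]}[m]}; tupolyP : tupoly_poly \in tupoly_pred }.

HB.instance Definition _ := [isSub for tupoly_poly].
HB.instance Definition _ := [Choice of tupoly by <:].
HB.instance Definition _ := GRing.SubChoice_isSubComNzRing.Build _ _ tupoly tupoly_subring.

Definition fpoly (i : 'I_m) : {mpoly {mpoly C[n]}[m]} :=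
  \prod_(j < n) ('X_i - ('X_j)%:MP).

Definition jpoly (k : nat) : {mpoly {mpoly C[n]}[m]} :=
  \sum_(i < m) 'X_i ^+ k * fpoly i.

Lemma jpoly_tupoly k : jpoly k \in tupoly_pred.
Proof.
apply/andP; split.
  apply: rpred_sum => i _; apply: rpredM; first exact/rpredX/mpolyOverX.
  apply/mpolyOverP => a; apply/issymP => s.
  rewrite -[LHS]mcoeff_map_mpoly; congr (_@__); rewrite /fpoly rmorph_prod /=.
  rewrite [RHS](reindex_perm s) /=; apply: eq_bigr => j _.
  rewrite rmorphB /= [map_mpoly _ 'X_i]mmapX mmap1U [map_mpoly _ _%:MP]mmapC /=.
  by rewrite [msym s 'X_j]mmapX mmap1U.
apply/issymP => s; rewrite /jpoly raddf_sum [RHS](reindex_perm s) /=; apply: eq_bigr => i _.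
rewrite rmorphM rmorphXn rmorph_prod /= /msym mmapX mmap1U; congr (_ * _).
by apply: eq_bigr => j _; rewrite rmorphB /= mmapX mmap1U mmapC.
Qed.

Definition jgen (k : nat) : tupoly := TUPoly (jpoly_tupoly k).

Definition Jideal : {pred tupoly} :=
  fun x => asbool (exists a : 'I_m -> tupoly, x = \sum_(k < m) a k * jgen k).

Lemma diag_tupoly (c : glinv) : (diag_restrict (glinv_poly c))%:MP \in tupoly_pred.
Proof.
case: c => c /asboolP c_inv /=; apply/andP; split.
  by rewrite mpolyOverC; apply/issymP => s; apply: msym_diag_restrict.
by apply/issymP => s; rewrite /msym mmapC.
Qed.

(* the S(gl_n^* )^gl_n-algebra structure of C[t]^S_n [u]^S_m *)
Definition tupoly_base (c : glinv) : tupoly := TUPoly (diag_tupoly c).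

Lemma tupoly_base_is_zmod_morphism : zmod_morphism tupoly_base.
Proof. by move=> c d; apply: val_inj; rewrite /= /diag_restrict !rmorphB. Qed.

Lemma tupoly_base_is_monoid_morphism : monoid_morphism tupoly_base.
Proof.
by split=> [|c d]; apply: val_inj; rewrite /= /diag_restrict ?rmorphM ?rmorph1.
Qed.

HB.instance Definition _ :=
  GRing.isZmodMorphism.Build glinv tupoly tupoly_base tupoly_base_is_zmod_morphism.
HB.instance Definition _ :=
  GRing.isMonoidMorphism.Build glinv tupoly tupoly_base tupoly_base_is_monoid_morphism.

End Presentation.

(* {ideal_quot _} requires a proper ideal, and J = (1) when n = 0 < m. *)
Section JIdeal.
Variables (C : numClosedFieldType) (n m : nat).

Lemma Jideal_closed : idealr_closed (@Jideal C n.+1 m).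
Proof.
have J0 : 0 \in @Jideal C n.+1 m.
  apply/asboolP; exists (fun=> 0); rewrite big1 // => k _; exact: mul0r.
split=> //.
- pose ev : {rmorphism tupoly C n.+1 m -> C} :=
    meval (fun=> 0) \o (meval (fun=> 0) \o val).
  apply/negP => /asboolP[a /(congr1 ev)/eqP].
  have fpoly0 i : (fpoly C n.+1 (m := m) i).@[fun=> 0].@[fun=> 0] = 0.
    by rewrite /fpoly big_ord_recl !mevalM !mevalB mevalC !mevalXU meval0 subrr mul0r.
  have ev_jgen k : ev (jgen C n.+1 m k) = 0.
    rewrite /= /jpoly.
    rewrite [X in meval _ X](rmorph_sum (meval _)) [LHS](rmorph_sum (meval _)).
    by apply: big1 => i _; rewrite /= !mevalM fpoly0 mulr0.
  by rewrite rmorph1 rmorph_sum big1 ?oner_eq0 // => k _; rewrite rmorphM ev_jgen mulr0.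
- move=> a x y /asboolP[b ->] /asboolP[d ->]; apply/asboolP.
  exists (fun k => a * b k + d k); rewrite mulr_sumr -big_split.
  by apply: eq_bigr => k _; rewrite mulrDl mulrA.
Qed.

HB.instance Definition _ :=
  isIdealr.Build (tupoly C n.+1 m) (@Jideal C n.+1 m) Jideal_closed.

End JIdeal.

(* Main.v *)
Require Import Defs.
From HB Require Import structures.
From mathcomp Require Import all_boot all_order all_fingroup all_algebra.
From mathcomp Require Import ring spectral.
From mathcomp Require Import complex.
From mathcomp Require Import boolp reals.
From mathcomp Require Import mpoly.
Set Implicit Arguments.
Unset Strict Implicit.
Unset Printing Implicit Defensive.
Import GRing.Theory Num.Theory.
Local Open Scope ring_scope.

(* Restriction to diagonal matrices. The weights of S^m(C^n) are multiplicity
   free, so a map in the big algebra restricts on diag(t_1, ..., t_n) to a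
   diagonal matrix, with one entry in C[t] for each monomial of degree m, that
   is, for each multiset {i_1, ..., i_m} of indices. By equivariance and density
   of the diagonalizable matrices the restriction determines the map.
   Evaluation at u_j = t_(i_j) sends C[t]^S_n [u]^S_m to the same product of
   copies of C[t], and it remains to compare the images and to find the kernel.

   Images: with G_k the gradient of c_k, D(c_k) = pi(G_k), and antisymmetry of
   the second derivatives of minors gives D(pi(G_(k+1))) = -(n-k) pi(G_k). Hence
   D^q(c_(p+q)) is a multiple of pi(G_(p+1)) for q > 0. Cramer's rule for z + Y
   gives G_(k+1) = c_k - Y G_k, so that pi(G_(k+1)) restricts to
   \sum_i (-1)^i e_(k-i)(t) p_i(u), with p_i(u) the power sums. These elements,
   together with the e_k(t), generate C[t]^S_n [u]^S_m.

   Kernel: a symmetric p(u) in the kernel vanishes at all the points of the grid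
   {t_1, ..., t_n}^m, hence p = \sum_i f_i h_i for some polynomials h_i;
   symmetrizing in u and averaging over S_n turns this into an expression of p
   as a member of J. *)

(** * Symmetrization *)

Section Symmetrization.
Variables (K : comNzRingType) (m : nat).
Implicit Types (p q w : {mpoly K[m]}) (s : 'S_m).

Definition symz p : {mpoly K[m]} := \sum_(s : 'S_m) msym s p.

Definition psum b : {mpoly K[m]} := \sum_(j < m) 'X_j ^+ b.

Lemma symz_is_zmod_morphism : zmod_morphism symz.
Proof. by move=> p q; rewrite /symz -sumrB; apply: eq_bigr => s _; rewrite msymB. Qed.

HB.instance Definition _ :=
  GRing.isZmodMorphism.Build {mpoly K[m]} {mpoly K[m]} symz symz_is_zmod_morphism.

Lemma symz_msym s p : symz (msym s p) = symz p.
Proof.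
rewrite /symz [RHS](reindex_inj (mulgI s)) /=.
by apply: eq_bigr => s' _; rewrite msymMm.
Qed.

Lemma symzM p q : q \is symmetric -> symz (p * q) = symz p * q.
Proof.
move=> /issymP q_sym; rewrite /symz mulr_suml.
by apply: eq_bigr => s _; rewrite msymM q_sym.
Qed.

Lemma symzZ c p : symz (c *: p) = c *: symz p.
Proof. by rewrite /symz scaler_sumr; apply: eq_bigr => s _; rewrite msymZ. Qed.

Lemma symz_symmetric p : p \is symmetric -> symz p = p *+ m`!.
Proof.
move=> /issymP p_sym; rewrite /symz (eq_bigr (fun=> p)) //.
by rewrite sumr_const; congr (_ *+ _); rewrite -card_Sn; apply: eq_card => s; rewrite !inE.
Qed.

Lemma msymXU s i : msym s 'X_i = 'X_(s i) :> {mpoly K[m]}.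
Proof. by rewrite /msym mmapX mmap1U. Qed.

Lemma psum_symmetric b : psum b \is symmetric.
Proof.
apply/issymP => s; rewrite /psum raddf_sum [RHS](reindex_perm s) /=.
by apply: eq_bigr => i _; rewrite rmorphXn /= msymXU.
Qed.

(** All [F i] lie in one orbit, so they have the same symmetrization; both sides compute [symz] of
    the symmetric element [\sum_i F i]. *)
Lemma symz_orbit (F : 'I_m -> {mpoly K[m]}) (i0 : 'I_m) :
  (forall s i, msym s (F i) = F (s i)) -> symz (F i0) *+ m = (\sum_i F i) *+ m`!.
Proof.
move=> F_eq; have orbE i : symz (F i) = symz (F i0).
  by rewrite -(symz_msym (tperm i0 i) (F i0)) F_eq tpermL.
rewrite -[LHS](_ : symz (\sum_i F i) = _); last first.
  by rewrite raddf_sum (eq_bigr (fun=> symz (F i0))) ?sumr_const ?card_ord.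
apply: symz_symmetric; apply/issymP => s; rewrite raddf_sum [RHS](reindex_perm s).
by apply: eq_bigr => i _; rewrite /= F_eq.
Qed.

Definition supp_off (i0 : 'I_m) (a : 'X_{1..m}) := [set j | (a j != 0%N) && (j != i0)].

(* Multiplying by a power sum adjoins one more variable to a monomial, up to
   monomials in fewer variables; hence the induction on the number of variables
   other than the distinguished one. *)
Lemma symz_monomial_ind w (i0 : 'I_m) (P : {mpoly K[m]} -> Prop) :
    (forall s, s i0 = i0 -> msym s w = w) ->
    (forall x y, P x -> P y -> P (x - y)) ->
    (forall b x, P x -> P (x * psum b)) ->
    (forall k x, P (x *+ k.+1) -> P x) ->
    (forall b, P (symz (w * 'X_i0 ^+ b))) ->
  forall a, P (symz (w * 'X_[a])).
Proof.
move=> w_inv PB PM Pdiv Pbase a.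
have [N] := ubnP #|supp_off i0 a|; elim: N a => // N IH a; rewrite ltnS => le_aN.
have P0 : P 0 by rewrite -(subrr (symz (w * 'X_i0 ^+ 0))); exact: PB.
have Psum (I : finType) (Q : pred I) F : (forall i, Q i -> P (F i)) -> P (\sum_(i | Q i) F i).
  move=> PF; elim/big_rec: _ => // i x Qi Px.
  by rewrite -[x]opprK -[- x]sub0r; apply: PB (PB _ _ P0 Px); exact: PF.
have [a0|[l]] := set_0Vmem (supp_off i0 a).
  suff -> : 'X_[a] = 'X_i0 ^+ a i0 :> {mpoly K[m]} by [].
  rewrite mpolyXn; congr 'X_[_]; apply/mnmP => j; rewrite mulmnE mnm1E.
  have [<-|neq_j] := eqVneq i0 j; first by rewrite mul1n.
  have := in_set0 j; rewrite -a0 inE [j == i0]eq_sym neq_j andbT => /negbFE/eqP ->.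
  by rewrite mul0n.
rewrite inE => /andP[al_neq0 neq_l].
(* Strip the variable of index [l] from the monomial; [b] is its exponent. *)
pose b := a l; pose a' := [multinom if j == l then 0%N else a j | j < m].
have aE : a = (a' + U_(l) *+ b)%MM.
  apply/mnmP => j; rewrite mnmDE mnmE mulmnE mnm1E eq_sym.
  by case: (eqVneq l j) => [<-|_]; rewrite ?mul1n ?mul0n ?addn0.
pose Z := i0 |: supp_off i0 a'.
have suppZ j : j \in Z -> supp_off i0 (a' + U_(j) *+ b)%MM = supp_off i0 a'.
  move=> jZ; apply/setP => k; rewrite !inE mnmDE mulmnE mnm1E.
  case: (eqVneq j k) jZ => [<-|_ _]; last by rewrite mul0n addn0.
  rewrite !inE; have [->|_] /= := eqVneq j i0; first by rewrite !andbF.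
  by rewrite !andbT addn_eq0 negb_and => ->.
have lt_a' : (#|supp_off i0 a'| < N)%N.
  apply: leq_trans le_aN; apply: proper_card; apply/properP; split.
    apply/subsetP => j; rewrite !inE mnmE; have [//|_] := eqVneq j l.
    by [].
  by exists l; rewrite !inE ?al_neq0 ?neq_l // mnmE eqxx.
have lZ : l \notin Z by rewrite !inE negb_or neq_l mnmE eqxx.
(* The transposition of [l] and [j] fixes [i0], hence [w], and fixes [a'], which has exponent 0 at
   both indices. *)
have symZ j : j \notin Z -> symz (w * 'X_[a' + U_(j) *+ b]) = symz (w * 'X_[a]).
  rewrite !inE negb_or => /andP[neq_j]; rewrite neq_j andbT negbK => /eqP a'j.
  rewrite -(symz_msym (tperm l j)) msymM w_inv; last by rewrite tpermD.
  rewrite msymX aE; congr (symz (w * 'X_[_])); apply/mnmP => k.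
  rewrite mnmE !mnmDE !mulmnE !mnm1E tpermV.
  have a'l : a' l = 0%N by rewrite mnmE eqxx.
  case: tpermP => [->|->|/eqP kl /eqP kj]; rewrite ?eqxx ?a'l ?a'j //.
    by rewrite eq_sym.
  by rewrite ![_ == k]eq_sym (negPf kl) (negPf kj).
(* Indices in [Z] bring in no new variable, so the induction hypothesis covers their terms. Every
   index outside [Z] contributes the term of [l], whose multiplicity is positive and can be divided
   out. *)
have prodE : symz (w * 'X_[a']) * psum b
    = \sum_(j in Z) symz (w * 'X_[a' + U_(j) *+ b]) + symz (w * 'X_[a]) *+ #|~: Z|.
  rewrite -symzM ?psum_symmetric // mulr_sumr raddf_sum (bigID (mem Z)) /=; congr (_ + _).
    by apply: eq_bigr => j _; rewrite mpolyXn -mulrA -mpolyXD.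
  rewrite -sumr_const; apply: eq_big => [j|j jZ]; first by rewrite [in RHS]in_setC.
  by rewrite mpolyXn -mulrA -mpolyXD symZ.
have : P (symz (w * 'X_[a]) *+ #|~: Z|).
  rewrite -[X in P X](addKr (\sum_(j in Z) symz (w * 'X_[a' + U_(j) *+ b]))) -prodE addrC.
  apply: PB; first exact/PM/IH.
  by apply: Psum => j jZ; apply: IH; rewrite suppZ.
have : (0 < #|~: Z|)%N by apply/card_gt0P; exists l; rewrite inE.
by case: #|~: Z| => // k _ /Pdiv.
Qed.

End Symmetrization.

Lemma horner_prod_XsubC (R : comNzRingType) (I : finType) (x : I -> R) i :
  (\prod_j ('X - (x j)%:P)).[x i] = 0.
Proof. by rewrite horner_prod (bigD1 i) //= hornerXsubC subrr mul0r. Qed.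

(** * Symmetric members of the ideal generated by the f_i *)

Section SymmetrizedIdeal.
Variables (K : comUnitRingType) (m : nat).
Hypothesis natU : forall k, (k.+1%:R : K) \is a GRing.unit.
Variable f : 'I_m -> {mpoly K[m]}.
Hypothesis f_eq : forall (s : 'S_m) i, msym s (f i) = f (s i).

Definition pmoment k : {mpoly K[m]} := \sum_i 'X_i ^+ k * f i.

(** This is J before symmetry in the t's is imposed: the coefficients are symmetric in the u's
    only. *)
Definition moment_ideal (x : {mpoly K[m]}) : Prop :=
  exists2 a : 'I_m -> {mpoly K[m]},
    forall k, a k \is symmetric & x = \sum_(k < m) a k * pmoment k.

Lemma moment_idealD x y : moment_ideal x -> moment_ideal y -> moment_ideal (x + y).
Proof.
move=> [a a_sym ->] [b b_sym ->]; exists (fun k => a k + b k).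
  by move=> k; exact: rpredD.
by rewrite -big_split; apply: eq_bigr => k _; rewrite mulrDl.
Qed.

Lemma moment_idealM c x : c \is symmetric -> moment_ideal x -> moment_ideal (c * x).
Proof.
move=> c_sym [a a_sym ->]; exists (fun k => c * a k); first by move=> k; exact: rpredM.
by rewrite mulr_sumr; apply: eq_bigr => k _; rewrite mulrA.
Qed.

Lemma moment_idealZ c x : moment_ideal x -> moment_ideal (c *: x).
Proof.
by move=> x_J; rewrite -mul_mpolyC; apply: moment_idealM; rewrite // -alg_mpolyC rpredZ // rpred1.
Qed.

Lemma moment_ideal0 : moment_ideal 0.
Proof. by exists (fun=> 0) => [k|]; rewrite ?rpred0 // big1 // => k _; rewrite mul0r. Qed.

Lemma moment_ideal_sum (I : Type) (r : seq I) (Q : pred I) F :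
  (forall i, Q i -> moment_ideal (F i)) -> moment_ideal (\sum_(i <- r | Q i) F i).
Proof.
move=> FJ; elim/big_ind: _ => //; [exact: moment_ideal0 | exact: moment_idealD].
Qed.

Lemma moment_idealB x y : moment_ideal x -> moment_ideal y -> moment_ideal (x - y).
Proof.
by move=> xJ yJ; rewrite -scaleN1r; apply: moment_idealD => //; exact: moment_idealZ.
Qed.

Lemma moment_ideal_div k x : moment_ideal (x *+ k.+1) -> moment_ideal x.
Proof.
move=> /(moment_idealZ k.+1%:R^-1); rewrite -scaler_nat scalerA mulVr ?scale1r //.
Qed.

(* Every u_i is a root of the monic polynomial \prod_j (X - u_j), whose
   coefficients are symmetric: this bounds the exponents by m. *)
Lemma pmoment_ideal k : moment_ideal (pmoment k).
Proof.
pose G : {poly {mpoly K[m]}} := \prod_(j < m) ('X - ('X_j)%:P).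
have G_sym l : G`_l \is symmetric.
  apply/issymP => s; rewrite -coef_map /=; have -> // : map_poly (msym s) G = G.
  rewrite rmorph_prod /= [RHS](reindex_perm s) /=; apply: eq_bigr => j _.
  by rewrite rmorphB /= map_polyX map_polyC /= msymXU.
have sizeG : size G = m.+1 by rewrite size_prod_XsubC -sum1_size sum1_card card_ord.
have leadG : G`_m = 1.
  by have := monic_prod_XsubC (index_enum 'I_m) xpredT (fun j => 'X_j : {mpoly K[m]});
     rewrite monicE /lead_coef sizeG => /eqP.
have GX i : 'X_i ^+ m = - \sum_(l < m) G`_l * 'X_i ^+ l :> {mpoly K[m]}.
  have: G.['X_i] = 0 by exact: (horner_prod_XsubC (fun j => 'X_j)).
  by rewrite horner_coef sizeG big_ord_recr /= leadG mul1r addrC => /eqP; rewrite addr_eq0 => /eqP.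
elim/ltn_ind: k => k IH; have [lt_km|le_mk] := ltnP k m.
  exists (fun l => (l == Ordinal lt_km)%:R) => [l|]; first by case: eqP => _; rewrite ?rpred1 ?rpred0.
  rewrite (bigD1 (Ordinal lt_km)) //= eqxx mul1r big1 ?addr0 // => l /negPf ->.
  by rewrite mul0r.
(* The relation [GX] multiplied by the power k - m of the variable. *)
have -> : pmoment k = \sum_(l < m) - G`_l * pmoment (k - m + l).
  rewrite /pmoment -{1}(subnK le_mk).
  under eq_bigr do rewrite exprD GX mulrN mulNr mulr_sumr mulr_suml -sumrN.
  rewrite exchange_big; apply: eq_bigr => l _; rewrite mulr_sumr; apply: eq_bigr => i _.
  by rewrite exprD; ring.
apply: moment_ideal_sum => l _; apply: moment_idealM; first by rewrite rpredN.
by apply: IH; rewrite -[X in (_ < X)%N](subnK le_mk) ltn_add2l.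
Qed.

(** The induction on monomials applies with weight [f i], which is fixed by the permutations fixing
    [i]. In its base case [symz_orbit] turns the symmetrization into a rational multiple of
    [pmoment b]. *)
Lemma symz_moment_ideal (i : 'I_m) h : moment_ideal (symz (f i * h)).
Proof.
have Pdiv := moment_ideal_div.
rewrite [h]mpolyE mulr_sumr raddf_sum; apply: moment_ideal_sum => a _ /=.
rewrite -scalerAr symzZ; apply: moment_idealZ.
apply: (symz_monomial_ind (i0 := i) (P := moment_ideal)) => //.
- by move=> s si; rewrite f_eq si.
- exact: moment_idealB.
- by move=> b x xJ; rewrite mulrC; apply: moment_idealM => //; exact: psum_symmetric.
- move=> b; have m0 : (0 < m)%N by apply: leq_ltn_trans (ltn_ord i).
  apply: (Pdiv m.-1); rewrite prednK //.
  rewrite (_ : f i * _ = 'X_i ^+ b * f i); last by rewrite mulrC.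
  rewrite (symz_orbit (F := fun j => 'X_j ^+ b * f j)); last first.
    by move=> s j; rewrite msymM rmorphXn /= msymXU f_eq.
  by rewrite -scaler_nat; apply/moment_idealZ/pmoment_ideal.
Qed.

(** A symmetric element is its own symmetrization divided by m!, and symmetrization can be applied
    summand by summand. *)
Lemma symmetric_moment_ideal (h : 'I_m -> {mpoly K[m]}) :
  \sum_i f i * h i \is symmetric -> moment_ideal (\sum_i f i * h i).
Proof.
move=> h_sym; apply: (@moment_ideal_div (m`!).-1); rewrite prednK ?fact_gt0 //.
rewrite -symz_symmetric // raddf_sum; apply: moment_ideal_sum => i _.
exact: symz_moment_ideal.
Qed.

End SymmetrizedIdeal.

(** * The kernel of the evaluation at the weights *)

Section GridInterpolation.
Variables (K : idomainType) (m n : nat) (t : 'I_n.+1 -> K).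
Hypothesis t_inj : injective t.
Implicit Types (p : {mpoly K[m]}) (a : {ffun 'I_m -> 'I_n.+1}).

Definition grid_poly (i : 'I_m) : {mpoly K[m]} := \prod_(j < n.+1) ('X_i - (t j)%:MP).

(** Factors of the Newton interpolation basis. Unlike monomials, these products make evaluation on
    the grid triangular. *)
Definition newton_factor (i : 'I_m) (k : nat) : {mpoly K[m]} :=
  \prod_(j < n.+1 | (j < k)%N) ('X_i - (t j)%:MP).

Definition newton_poly a : {mpoly K[m]} := \prod_i newton_factor i (a i).

Lemma newton_factorS i (k : 'I_n.+1) :
  newton_factor i k.+1 = newton_factor i k * ('X_i - (t k)%:MP).
Proof.
rewrite /newton_factor (bigD1 k) //= mulrC; congr (_ * _); apply: eq_bigl => j.
by rewrite ltnS ltn_neqAle -val_eqE andbC.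
Qed.

Lemma newton_factor_max i : newton_factor i n.+1 = grid_poly i.
Proof. by apply: eq_bigl => j; rewrite ltn_ord. Qed.

Definition newton_spanned p : Prop :=
  exists c : {ffun 'I_m -> 'I_n.+1} -> K, exists h : 'I_m -> {mpoly K[m]},
    p = \sum_a c a *: newton_poly a + \sum_i grid_poly i * h i.

Lemma newton_spannedD p q :
  newton_spanned p -> newton_spanned q -> newton_spanned (p + q).
Proof.
move=> [c [h ->]] [d [k ->]]; exists (fun a => c a + d a), (fun i => h i + k i).
rewrite addrACA -!big_split /=; congr (_ + _); apply: eq_bigr => ? _.
  by rewrite scalerDl.
by rewrite mulrDr.
Qed.

Lemma newton_spannedZ b p : newton_spanned p -> newton_spanned (b *: p).
Proof.
move=> [c [h ->]]; exists (fun a => b * c a), (fun i => b *: h i).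
rewrite scalerDr !scaler_sumr; congr (_ + _); apply: eq_bigr => ? _.
  by rewrite scalerA.
by rewrite scalerAr.
Qed.

Lemma newton_spanned_sum (I : Type) (r : seq I) F :
  (forall i, newton_spanned (F i)) -> newton_spanned (\sum_(i <- r) F i).
Proof.
move=> FE; elim/big_rec: _ => [|i p _ pE]; last exact: newton_spannedD.
exists (fun=> 0), (fun=> 0); rewrite !big1 ?addr0 // => i _; first by rewrite mulr0.
by rewrite scale0r.
Qed.

Lemma newton_spanned_newton a : newton_spanned (newton_poly a).
Proof.
exists (fun b => (b == a)%:R), (fun=> 0).
rewrite (bigD1 a) //= eqxx scale1r big1 => [|b /negPf ->]; last by rewrite scale0r.
by rewrite addr0 big1 ?addr0 // => i _; rewrite mulr0.
Qed.

Lemma newton_spanned_grid i h : newton_spanned (grid_poly i * h).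
Proof.
exists (fun=> 0), (fun j => if j == i then h else 0).
rewrite big1 => [|b _]; last by rewrite scale0r.
rewrite add0r (bigD1 i) //= eqxx big1 ?addr0 // => j /negPf ->.
by rewrite mulr0.
Qed.

(** Write the variable as ('X_i - t_(a i)) + t_(a i). The first term raises the index [a i] by one,
    or completes [grid_poly i] when that index is already maximal; the second is a scalar. *)
Lemma newton_spannedX i p : newton_spanned p -> newton_spanned (p * 'X_i).
Proof.
move=> [c [h ->]]; rewrite mulrDl; apply: newton_spannedD; rewrite mulr_suml.
  apply: newton_spanned_sum => a; rewrite -scalerAl; apply: newton_spannedZ.
  rewrite -[X in _ * X](subrK (t (a i))%:MP) mulrDr; apply: newton_spannedD; last first.
    by rewrite mulrC mul_mpolyC; apply/newton_spannedZ/newton_spanned_newton.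
  rewrite /newton_poly (bigD1 i) //= mulrAC -newton_factorS.
  have [lt_a|le_a] := ltnP (a i).+1 n.+1; last first.
    have -> : (a i).+1 = n.+1 by apply/eqP; rewrite eqn_leq le_a ltn_ord.
    by rewrite newton_factor_max; exact: newton_spanned_grid.
  pose a' := [ffun j => if j == i then Ordinal lt_a else a j].
  suff <- : newton_poly a' = newton_factor i (a i).+1 * \prod_(j | j != i) newton_factor j (a j).
    exact: newton_spanned_newton.
  rewrite /newton_poly (bigD1 i) //= ffunE eqxx; congr (_ * _).
  by apply: eq_bigr => j /negPf neq_j; rewrite ffunE neq_j.
by apply: newton_spanned_sum => j; rewrite -mulrA; exact: newton_spanned_grid.
Qed.

Lemma newton_spanning p : newton_spanned p.
Proof.
rewrite [p]mpolyE; apply: newton_spanned_sum => a; apply: newton_spannedZ.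
rewrite mpolyXE_id; elim/big_rec: _ => [|i q _ qE].
  suff <- : newton_poly [ffun=> ord0] = 1 by exact: newton_spanned_newton.
  by apply: big1 => i _; apply: big1 => j; rewrite ffunE.
rewrite mulrC; elim: (a i) => [|e IH]; first by rewrite mulr1.
by rewrite exprSr mulrA; exact: newton_spannedX.
Qed.

Lemma newton_factor_eval i k a :
  ((newton_factor i k).@[fun j => t (a j)] == 0) = (a i < k)%N.
Proof.
rewrite /newton_factor rmorph_prod /= prodf_seq_eq0; apply/hasP/idP => [[j _ /andP[lt_j]]|lt_a].
  by rewrite mevalB mevalXU mevalC subr_eq0 => /eqP/t_inj ->.
exists (a i); first exact: mem_index_enum.
by rewrite lt_a mevalB mevalXU mevalC subrr eqxx.
Qed.

(** At the point of index [a], [newton_poly b] is nonzero exactly when b <= a in every coordinate.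
    The Newton coefficients therefore vanish one after the other, by induction on the sum of the
    coordinates of [a]. *)
Lemma vanishing_on_grid p : (forall a, p.@[fun j => t (a j)] = 0) ->
  exists h : 'I_m -> {mpoly K[m]}, p = \sum_i grid_poly i * h i.
Proof.
move=> p0; have [c [h pE]] := newton_spanning p; exists h.
suff c0 a : c a = 0 by rewrite {1}pE big1 ?add0r // => a _; rewrite c0 scale0r.
have [N] := ubnP (\sum_i a i)%N; elim: N a => // N IH a; rewrite ltnS => le_aN.
have := p0 a; rewrite pE mevalD [X in _ + X]raddf_sum [X in _ + X]big1 ?addr0; last first.
  move=> i _; rewrite /= mevalM -newton_factor_max.
  by rewrite (_ : meval _ _ = 0) ?mul0r //; apply/eqP; rewrite newton_factor_eval ltn_ord.
rewrite raddf_sum (bigD1 a) //= big1 ?addr0 => [|b neq_ba].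
  rewrite mevalZ => /eqP; rewrite mulf_eq0 => /orP[/eqP //|].
  rewrite /newton_poly rmorph_prod prodf_seq_eq0 => /hasP[i _] /=.
  by rewrite newton_factor_eval ltnn.
rewrite mevalZ; have [/forallP le_ba|] := boolP [forall i, b i <= a i]%N.
  rewrite IH ?mul0r //; apply: leq_trans le_aN.
  have [i neq_i] : exists i, b i != a i.
    by apply/existsP; rewrite -negb_forall; apply: contra neq_ba => /eqfunP/ffunP ->.
  rewrite (bigD1 i) //= [X in (_ < X)%N](bigD1 i) //=.
  rewrite -addSn leq_add ?leq_sum // ltn_neqAle le_ba andbT.
  by rewrite val_eqE.
move=> le_ba; have [i lt_ab] : exists i, (a i < b i)%N.
  apply/existsP; rewrite -[X in is_true X]negbK negb_exists; apply: contra le_ba => /forallP le_ba.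
  by apply/forallP => i; rewrite leqNgt.
rewrite /newton_poly rmorph_prod (bigD1 i) //=.
by rewrite (_ : meval _ _ = 0) ?mul0r ?mulr0 //; apply/eqP; rewrite newton_factor_eval.
Qed.

End GridInterpolation.

Lemma map_mpoly_msym (A B : nzRingType) (f : {rmorphism A -> B}) N (s : 'S_N) p :
  map_mpoly f (msym s p) = msym s (map_mpoly f p).
Proof. by apply/mpolyP => a; rewrite mcoeff_sym !mcoeff_map_mpoly mcoeff_sym. Qed.

Lemma map_mpoly_map (A B D : nzRingType) (g : {additive A -> B}) (f : {additive B -> D})
    (h : {additive A -> D}) N (p : {mpoly A[N]}) :
  (forall x, f (g x) = h x) -> map_mpoly f (map_mpoly g p) = map_mpoly h p.
Proof. by move=> fg; apply/mpolyP => a; rewrite !mcoeff_map_mpoly fg. Qed.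

(** * Elements vanishing on the grid lie in J *)

Section KernelOfEvaluation.
Variables (C : numClosedFieldType) (n m : nat).
Local Notation K := {mpoly C[n.+1]}.

Lemma mpoly_nat_unit N k : (k.+1%:R : {mpoly C[N]}) \is a GRing.unit.
Proof. by rewrite -mpolyC_nat; apply: rmorph_unit; rewrite unitfE pnatr_eq0. Qed.

Lemma msym_fpoly (s : 'S_m) i : msym s (fpoly C n.+1 i) = fpoly C n.+1 (s i).
Proof.
rewrite /fpoly rmorph_prod; apply: eq_bigr => j _ /=.
by rewrite rmorphB /= msymXU /msym mmapC.
Qed.

(** Permutation of the t's. It acts on coefficients only and hence commutes with permutations of the
    u's. *)
Definition tsym (s : 'S_n.+1) : {mpoly K[m]} -> {mpoly K[m]} := map_mpoly (msym s).

HB.instance Definition _ s := GRing.RMorphism.copy (tsym s) (map_mpoly (msym s)).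

Lemma mcoeff_tsym s p e : (tsym s p)@_e = msym s p@_e.
Proof. exact: mcoeff_map_mpoly. Qed.

Lemma tsym_jpoly s k : tsym s (jpoly C n.+1 m k) = jpoly C n.+1 m k.
Proof.
apply/mpolyP => a; rewrite mcoeff_tsym.
have /andP[/mpolyOverP/(_ a)/issymP j_sym _] := jpoly_tupoly C n.+1 m k.
exact: j_sym.
Qed.

Lemma tsym_msym s (s' : 'S_m) p : tsym s (msym s' p) = msym s' (tsym s p).
Proof. exact: map_mpoly_msym. Qed.

(** Interpolation gives p = \sum_i f_i h_i, and symmetrization in the u's gives coefficients [a k]
    symmetric in the u's. Since [p] and the generators of J are fixed by [tsym], averaging over the
    permutations of the t's makes the coefficients symmetric in the t's as well. *)
Lemma tupoly_vanishing (p : tupoly C n.+1 m) :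
    (forall a : {ffun 'I_m -> 'I_n.+1}, (tupoly_poly p).@[fun j => 'X_(a j)] = 0) ->
  p \in @Jideal C n.+1 m.
Proof.
case: p => p p_tu /= p0; have /andP[p_t p_u] := p_tu.
have t_inj : injective (fun j : 'I_n.+1 => 'X_j : K).
  move=> i j eq_ij; have := mcoeffXU C i j; rewrite eq_ij mcoeffXU eqxx.
  by case: eqP => // _ /eqP; rewrite mulr1n mulr0n oner_eq0.
have [h pE] := vanishing_on_grid t_inj p0.
have [a a_sym {}pE] : moment_ideal (@fpoly C n.+1 m) p.
  rewrite pE; apply: symmetric_moment_ideal; first exact: mpoly_nat_unit.
    exact: msym_fpoly.
  by rewrite -[X in X \is _]pE.
pose c : K := (n.+1)`!%:R^-1.
have c_sym s : msym s c = c by rewrite /c rmorphV ?rmorph_nat // -(prednK (fact_gt0 _)) mpoly_nat_unit.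
pose b k := c *: \sum_s tsym s (a k).
have b_tu k : b k \in @tupoly_pred C n.+1 m.
  apply/andP; split.
    apply/mpolyOverP => e; apply/issymP => s; rewrite -[LHS]mcoeff_tsym; congr (_@__).
    rewrite [LHS]map_mpolyZ /= c_sym; congr (_ *: _).
    rewrite [LHS](raddf_sum (tsym s)) [RHS](reindex_inj (mulIg s)) /=.
    by apply: eq_bigr => s' _; apply: map_mpoly_map => x; rewrite /= msymMm.
  apply/rpredZ/rpred_sum => s _; apply/issymP => s'.
  by rewrite -tsym_msym; have /issymP -> := a_sym k.
apply/asboolP; exists (fun k => TUPoly (b_tu k)); apply: val_inj.
rewrite [RHS](big_morph (@tupoly_poly C n.+1 m) (id1 := 0) (op1 := +%R)) //=.
have -> : p = c *: \sum_s tsym s p.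
  rewrite (eq_bigr (fun=> p)) => [|s _]; last first.
    apply/mpolyP => e; rewrite mcoeff_tsym.
    by have /mpolyOverP/(_ e)/issymP := p_t; apply.
  rewrite sumr_const (_ : #|_| = (n.+1)`!); last first.
    by rewrite -card_Sn; apply: eq_card => s; rewrite !inE.
  rewrite -scaler_nat scalerA mulVr ?scale1r //.
  by rewrite -(prednK (fact_gt0 _)) mpoly_nat_unit.
rewrite {1}pE (eq_bigr (fun s => \sum_(k < m) tsym s (a k) * jpoly C n.+1 m k)); last first.
  by move=> s _; rewrite rmorph_sum; apply: eq_bigr => k _; rewrite rmorphM /= -[in RHS](tsym_jpoly s k).
rewrite exchange_big scaler_sumr; apply: eq_bigr => k _ /=.
by rewrite -mulr_suml scalerAl.
Qed.

End KernelOfEvaluation.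

(** * Determinants *)

Section Determinants.
Variables (S : comNzRingType) (n : nat).
Implicit Types (M : 'M[S]_n) (A : {set 'I_n}) (v : 'I_n -> S).

Definition set_row (r : 'I_n) v M : 'M[S]_n :=
  \matrix_(i, j) if i == r then v j else M i j.

(** Filling the rows outside [A] with those of the identity turns principal minors of all sizes into
    determinants of one size. *)
Definition mask_rows A M : 'M[S]_n :=
  \matrix_(i, j) if i \in A then M i j else (i == j)%:R.

Lemma det_set_row r v M : \det (set_row r v M) = \sum_l v l * cofactor M r l.
Proof.
rewrite (expand_det_row _ r); apply: eq_bigr => l _; rewrite mxE eqxx; congr (_ * _).
rewrite /cofactor; congr (_ * \det _); apply/matrixP => i j; rewrite !mxE.
by rewrite eq_sym (negPf (neq_lift _ _)).
Qed.

Lemma det_set_row_delta r a M : \det (set_row r (fun l => (l == a)%:R) M) = \adj M a r.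
Proof.
rewrite det_set_row (bigD1 a) //= eqxx mul1r big1 ?addr0 ?mxE // => l /negPf ->.
by rewrite mul0r.
Qed.

Lemma det_set_row0 r v M : (forall l, v l = 0) -> \det (set_row r v M) = 0.
Proof. by move=> v0; rewrite det_set_row big1 // => l _; rewrite v0 mul0r. Qed.

Lemma det_set_row_swap (r s : 'I_n) v w M : r != s ->
  \det (set_row r v (set_row s w M)) = - \det (set_row r w (set_row s v M)).
Proof.
move=> neq_rs; rewrite -[RHS]mulN1r.
have <- : \det (tperm_mx r s : 'M[S]_n) = -1 by rewrite det_perm odd_tperm neq_rs expr1.
rewrite -det_mulmx -xrowE; congr (\det _); apply/matrixP => i j; rewrite !mxE.
case: tpermP => [->|->|/eqP ir /eqP i_s]; rewrite ?eqxx ?(negPf neq_rs) 1?[s == r]eq_sym ?(negPf neq_rs) //.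
by rewrite (negPf ir) (negPf i_s).
Qed.

Lemma det_mxsub_bij p (f : 'I_p -> 'I_n) M : injective f -> p = n ->
  \det (mxsub f f M) = \det M.
Proof.
move=> f_inj eq_pn; case: _ / (esym eq_pn) M f f_inj => M f f_inj.
have -> : mxsub f f M = row_perm (perm f_inj) (col_perm (perm f_inj) M).
  by apply/matrixP => i j; rewrite !mxE !permE.
rewrite row_permE col_permE !det_mulmx !det_perm odd_permV mulrCA.
by rewrite -signr_addb addbb mulr1.
Qed.

(** Listing the indices of [A] first makes the masked matrix block upper triangular, with an
    identity block in the lower right corner. *)
Lemma det_mxsub_enum A M :
  \det (mxsub (@enum_val _ (mem A)) (@enum_val _ (mem A)) M) = \det (mask_rows A M).
Proof.
pose f (i : 'I_(#|A| + #|~: A|)) : 'I_n :=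
  match split i with inl a => @enum_val _ (mem A) a | inr b => @enum_val _ (mem (~: A)) b end.
have f_inj : injective f.
  move=> i j; rewrite /f => eq_ij; apply: (can_inj splitK).
  case: (split i) (split j) eq_ij => [a|b] [a'|b'] eq_ij.
  - by congr inl; exact: enum_val_inj eq_ij.
  - by have := enum_valP a; rewrite eq_ij -[_ \in _]negbK -in_setC (enum_valP b').
  - by have := enum_valP a'; rewrite -eq_ij -[_ \in _]negbK -in_setC (enum_valP b).
  - by congr inr; exact: enum_val_inj eq_ij.
rewrite -(det_mxsub_bij (mask_rows A M) f_inj); last by rewrite cardsC card_ord.
set N := mxsub f f _.
have NE : N = block_mx (mxsub (@enum_val _ (mem A)) (@enum_val _ (mem A)) M)
    (mxsub (@enum_val _ (mem A)) (@enum_val _ (mem (~: A))) M) 0 1%:M.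
  apply/matrixP => i j; rewrite !mxE /f.
  case: splitP => [a _|b _]; rewrite !mxE.
    by rewrite (enum_valP a); case: splitP => [a' _|b' _]; rewrite !mxE.
  have := enum_valP b; rewrite in_setC => /negPf ->.
  case: splitP => [a' _|b' _]; rewrite !mxE.
    case: eqP => // eq_ba; have := enum_valP b.
    by rewrite eq_ba in_setC (enum_valP a').
  by rewrite (inj_eq enum_val_inj).
by rewrite NE det_ublock det1 mulr1.
Qed.

Definition minor_sum k M : S := \sum_(A : {set 'I_n} | #|A| == k) \det (mask_rows A M).

Definition pencil M : 'M[{poly S}]_n := 'X%:M + map_mx polyC M.

(** In each factor of the Leibniz formula choose either the entry of [M] or the diagonal 'X; [A] is
    the set of rows where [M] is chosen. *)
Lemma det_pencil M : \det (pencil M) = \sum_(A : {set 'I_n}) (\det (mask_rows A M))%:P * 'X^(n - #|A|).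
Proof.
pose F (s : 'S_n) A : {poly S} := \prod_i if i \in A then (M i (s i))%:P else (i == s i)%:R * 'X.
transitivity (\sum_(s : 'S_n) (-1) ^+ s * \sum_(A in {set 'I_n}) F s A).
  apply: eq_bigr => s _; rewrite -bigA_distr; congr (_ * _); apply: eq_bigr => i _.
  by rewrite !mxE addrC mulr_natl.
under eq_bigr do rewrite mulr_sumr.
rewrite exchange_big; apply: eq_bigr => A _ /=.
rewrite /determinant rmorph_sum mulr_suml; apply: eq_bigr => s _.
rewrite rmorphM rmorph_sign -mulrA; congr (_ * _); rewrite rmorph_prod /=.
have -> : 'X^(n - #|A|) = \prod_i if i \in A then 1 else 'X :> {poly S}.
  rewrite [RHS](bigID (mem A)) /= big1 => [|i ->] //.
  rewrite mul1r (eq_bigr (fun=> 'X)) => [|i /negPf ->] //.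
  rewrite (eq_bigl (mem (~: A))) => [|i]; last by rewrite /= in_setC.
  by rewrite prodr_const cardsCs setCK card_ord.
rewrite -big_split; apply: eq_bigr => i _ /=; rewrite mxE.
by case: ifP => _; rewrite ?mulr1 // rmorph_nat.
Qed.

Lemma coef_det_pencil k M : (k <= n)%N -> (\det (pencil M))`_(n - k) = minor_sum k M.
Proof.
move=> le_kn; rewrite det_pencil coef_sum /minor_sum [RHS]big_mkcond /=.
apply: eq_bigr => A _; rewrite coefCM coefXn.
have le_A : (#|A| <= n)%N by rewrite -[X in (_ <= X)%N]card_ord max_card.
by rewrite eqn_sub2lE // eq_sym; case: ifP => _; rewrite (mulr1, mulr0).
Qed.

End Determinants.

Section DeterminantDerivation.
Variables (S : comNzRingType) (n : nat) (D : {additive S -> S}).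
Hypothesis DM : forall x y, D (x * y) = D x * y + x * D y.

Lemma derivation1 : D 1 = 0.
Proof. by apply: (@addrI _ (D 1)); rewrite addr0 -{3}[1]mulr1 DM mulr1 mul1r. Qed.

Lemma derivation_prod (I : eqType) (r : seq I) (F : I -> S) : uniq r ->
  D (\prod_(i <- r) F i) = \sum_(j <- r) \prod_(i <- r) if i == j then D (F i) else F i.
Proof.
elim: r => [|k r IH] /=; first by rewrite !big_nil derivation1.
case/andP=> kr r_uniq; rewrite !big_cons DM IH // eqxx; congr (_ * _ + _).
  by apply: eq_big_seq => i ir; case: eqP ir kr => // -> ->.
rewrite mulr_sumr; apply: eq_big_seq => j jr; rewrite big_cons.
by case: eqP jr kr => // -> ->.
Qed.

Lemma derivation_det (M : 'M[S]_n) :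
  D (\det M) = \sum_r \det (set_row r (fun l => D (M r l)) M).
Proof.
rewrite /determinant raddf_sum exchange_big; apply: eq_bigr => s _.
have DX : D ((-1) ^+ s) = 0.
  by case: (s : bool); rewrite ?expr0 ?expr1 ?raddfN derivation1 ?oppr0.
rewrite [LHS]DM DX mul0r add0r derivation_prod ?index_enum_uniq // mulr_sumr.
apply: eq_bigr => r _; congr (_ * _); apply: eq_bigr => i _; rewrite mxE.
by case: eqP => // ->.
Qed.

Lemma derivation_det_row (M : 'M[S]_n) r v :
    (forall i l, D (M i l) = if i == r then v l else 0) ->
  D (\det M) = \det (set_row r v M).
Proof.
move=> DMr; rewrite derivation_det (bigD1 r) //= big1 ?addr0 => [|i neq_ir].
  by congr (\det _); apply/matrixP => i l; rewrite !mxE DMr eqxx.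
by apply: det_set_row0 => l; rewrite DMr (negPf neq_ir).
Qed.

End DeterminantDerivation.

(** * Characteristic coefficients and their gradients *)

Section CharacteristicCoefficients.
Variables (C : numClosedFieldType) (n : nat).
Local Notation S := {mpoly C[n * n]}.
Local Notation Y := (ymx C n).
Local Notation W := (pencil Y).

HB.instance Definition _ i j :=
  GRing.Linear.copy (@yderiv C n i j) (mderiv (mxvec_index i j)).

HB.instance Definition _ :=
  GRing.RMorphism.copy (@diag_restrict C n)
    (comp_mpoly [tuple mxvec (diag_mx (\row_(i < n) 'X_i)) 0 k | k < n * n]).

Lemma yderivM i j (c d : S) : yderiv i j (c * d) = yderiv i j c * d + c * yderiv i j d.
Proof. exact: mderivM. Qed.

Lemma yderivC i j (a : C) : yderiv i j (a%:MP : S) = 0.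
Proof. exact: mderivC. Qed.

Lemma yderiv_ymx i j a b : yderiv i j (Y a b) = ((a == i) && (b == j))%:R.
Proof.
rewrite mxE /yderiv /ycoord mderivX mnm1E.
have -> : (mxvec_index a b == mxvec_index i j) = (a == i) && (b == j).
  by rewrite (inj_eq (@cast_ord_inj _ _ _)) (inj_eq enum_rank_inj) xpair_eqE.
case: andP => [[/eqP-> /eqP->]|_]; last by rewrite scale0r.
rewrite scale1r (_ : (U_(_) - U_(_))%MM = 0%MM) ?mpolyX0 //.
by apply/mnmP => k; rewrite mnmBE subnn mnm0E.
Qed.

Lemma cpoly_minor_sum k : cpoly C n k = minor_sum k Y.
Proof. by apply: eq_bigr => A _; rewrite det_mxsub_enum. Qed.

Lemma cpoly_coef k : (k <= n)%N -> cpoly C n k = (\det W)`_(n - k).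
Proof. by move=> le_kn; rewrite coef_det_pencil // cpoly_minor_sum. Qed.

Lemma cpoly_gt k : (n < k)%N -> cpoly C n k = 0.
Proof.
move=> lt_nk; rewrite /cpoly big_pred0 // => A; apply/eqP => kA.
by have := max_card (mem A); rewrite kA card_ord leqNgt lt_nk.
Qed.

Lemma cpoly0 : cpoly C n 0 = 1.
Proof.
rewrite cpoly_minor_sum /minor_sum (big_pred1 set0) => [|A]; last by rewrite /= cards_eq0.
rewrite [mask_rows _ _](_ : _ = 1%:M) ?det1 //.
by apply/matrixP => i j; rewrite !mxE in_set0.
Qed.

(** The extension of d/dy_ij to polynomials in z that kills z, so that all the [cpoly] are
    differentiated at once through det(z + Y). *)
Definition coef_yderiv i j : {poly S} -> {poly S} := map_poly (yderiv i j).

HB.instance Definition _ i j :=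
  GRing.Additive.copy (coef_yderiv i j) (map_poly (yderiv i j)).

Lemma coef_coef_yderiv i j (p : {poly S}) k : (coef_yderiv i j p)`_k = yderiv i j p`_k.
Proof. exact: coef_map. Qed.

Lemma coef_yderivM i j (p q : {poly S}) :
  coef_yderiv i j (p * q) = coef_yderiv i j p * q + p * coef_yderiv i j q.
Proof.
apply/polyP => k; rewrite coef_coef_yderiv coefD !coefM raddf_sum -big_split /=.
by apply: eq_bigr => l _; rewrite yderivM !coef_coef_yderiv.
Qed.

Lemma coef_yderiv_polyC i j c : coef_yderiv i j c%:P = (yderiv i j c)%:P.
Proof. exact: map_polyC. Qed.

Lemma coef_yderiv_nat i j k : coef_yderiv i j k%:R = 0.
Proof. by rewrite -polyC_natr coef_yderiv_polyC -mpolyC_nat yderivC. Qed.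

Lemma coef_yderiv_pencil i j a b :
  coef_yderiv i j (W a b) = if a == i then (b == j)%:R else 0.
Proof.
rewrite 2!mxE raddfD /= [in X in _ + X]mxE coef_yderiv_polyC yderiv_ymx.
have -> : coef_yderiv i j ('X *+ (a == b)) = 0.
  apply/polyP => k; rewrite coef_coef_yderiv coefMn coefX coef0 -mulrnA.
  by rewrite -mpolyC_nat yderivC.
by rewrite add0r; case: eqP => _; rewrite ?rmorph_nat // polyC0.
Qed.

(** Jacobi's formula: only row [i] depends on y_ij, and its derivative is the [j]-th unit row. *)
Lemma coef_yderiv_det_pencil i j : coef_yderiv i j (\det W) = \adj W j i.
Proof.
rewrite -det_set_row_delta; apply: derivation_det_row; first exact: coef_yderivM.
exact: coef_yderiv_pencil.
Qed.

(** The indices are transposed as in the operator D: this is the gradient with respect to the trace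
    form. *)
Definition cgrad k : 'M[S]_n := \matrix_(a, b) yderiv b a (cpoly C n k).

Lemma adj_pencil_coef k a b : (k <= n)%N -> (\adj W a b)`_(n - k) = cgrad k a b.
Proof.
by move=> le_kn; rewrite -coef_yderiv_det_pencil coef_coef_yderiv -cpoly_coef // mxE.
Qed.

Lemma cgrad_gt k : (n < k)%N -> cgrad k = 0.
Proof. by move=> lt_nk; apply/matrixP => a b; rewrite !mxE cpoly_gt // raddf0. Qed.

Lemma cgrad0 : cgrad 0 = 0.
Proof. by apply/matrixP => a b; rewrite !mxE cpoly0 -mpolyC1 yderivC. Qed.

(* The coefficients of (z + Y) adj(z + Y) = det(z + Y). *)
Lemma cgradS k : cgrad k.+1 = (cpoly C n k)%:M - Y *m cgrad k.
Proof.
have [lt_nk|le_kn] := ltnP n k.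
  by rewrite !cgrad_gt ?cpoly_gt // ?mulmx0 ?subr0 ?raddf0 // ltnW.
apply/matrixP => a b.
have := congr1 (fun M : 'M[{poly S}]_n => (M a b)`_(n - k)) (mul_mx_adj W).
have -> : (W *m \adj W) a b = 'X * \adj W a b + \sum_l (Y a l)%:P * \adj W l b.
  rewrite /pencil mulmxDl mul_scalar_mx mxE [X in X + _]mxE; congr (_ + _).
  by rewrite [LHS]mxE; apply: eq_bigr => l _; rewrite [X in X * _]mxE.
rewrite coefD coefXM coef_sum [X in _ + X](_ : _ = (Y *m cgrad k) a b); last first.
  by rewrite [RHS]mxE; apply: eq_bigr => l _; rewrite coefCM adj_pencil_coef.
rewrite [X in _ = X -> _](_ : _ = (cpoly C n k)%:M a b); last first.
  by rewrite !mxE coefMn cpoly_coef.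
(* For k = n the product with 'X has no constant term, in agreement with [cgrad n.+1] = 0. *)
set L := if _ then _ else _; have -> : L = cgrad k.+1 a b.
  rewrite /L; have [->|lt_kn] := eqVneq k n.
    by rewrite subnn eqxx cgrad_gt // mxE.
  have {}lt_kn : (k < n)%N by rewrite ltn_neqAle lt_kn.
  by rewrite subn_eq0 leqNgt lt_kn -subnS adj_pencil_coef.
by move=> E; rewrite [RHS]mxE [X in _ + X]mxE -E addrK.
Qed.

Lemma cgradC k : cgrad k *m Y = Y *m cgrad k.
Proof.
elim: k => [|k IH]; first by rewrite cgrad0 mulmx0 mul0mx.
by rewrite cgradS mulmxBl mulmxBr -mulmxA IH mul_scalar_mx mul_mx_scalar.
Qed.

(** The derivative along the commutator of Y and X is the trace of [cgrad k] times this commutator;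
    it vanishes because [cgrad k] commutes with Y. *)
Lemma cpoly_gl_invariant k : gl_invariant (cpoly C n k).
Proof.
move=> X; pose XS := map_mx (@mpolyC (n * n) C) X.
transitivity (\tr (cgrad k *m (Y *m XS - XS *m Y))).
  rewrite /gl_act /mxtrace exchange_big; apply: eq_bigr => j _.
  rewrite mxE; apply: eq_bigr => i _; congr (_ * _).
  by rewrite mxE.
rewrite mulmxBr raddfB /= !mulmxA cgradC.
rewrite -(mulmxA Y) mxtrace_mulC -(mulmxA (cgrad k)) [X in X - _]mxtrace_mulC.
by rewrite [X in X - _]mxtrace_mulC mulmxA subrr.
Qed.

(** A second derivative of det(z + Y) is the determinant with rows [j] and [b] replaced by unit
    rows, and 0 if the two rows coincide. Exchanging [i] and [a] swaps the two unit rows. *)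
Lemma cpoly_yderiv2_antisym k i j a b :
  yderiv j i (yderiv b a (cpoly C n k)) = - yderiv j a (yderiv b i (cpoly C n k)).
Proof.
have [lt_nk|le_kn] := ltnP n k; first by rewrite cpoly_gt // !raddf0.
rewrite cpoly_coef // -!coef_coef_yderiv -coefN; congr (_`_ _).
have D2 c d : coef_yderiv j d (coef_yderiv b c (\det W)) =
    if j == b then 0
    else \det (set_row j (fun l => (l == d)%:R) (set_row b (fun l => (l == c)%:R) W)).
  rewrite coef_yderiv_det_pencil -det_set_row_delta.
  pose v l : {poly S} := if j == b then 0 else (l == d)%:R.
  rewrite (@derivation_det_row _ _ _ (coef_yderivM j d) _ j v) /v.
    by case: eqP => // _; rewrite det_set_row0.
  move=> r l; rewrite mxE; case: (eqVneq r b) => [->|neq_rb].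
    by rewrite [LHS]coef_yderiv_nat eq_sym; case: eqP.
  rewrite [LHS]coef_yderiv_pencil; case: (eqVneq r j) neq_rb => // -> /negPf ->.
  by [].
rewrite !D2; case: eqP => [_|/eqP neq_jb]; first by rewrite oppr0.
by rewrite det_set_row_swap.
Qed.

(** Compare coefficients in d/dz det(z + Y) = \sum_b d/dy_bb det(z + Y), which holds because z
    enters only through the sums z + y_bb. *)
Lemma cpoly_yderiv_trace k :
  \sum_b yderiv b b (cpoly C n k.+1) = cpoly C n k *+ (n - k).
Proof.
have [le_nk|lt_kn] := leqP n k.
  rewrite cpoly_gt // (_ : (n - k)%N = 0%N); last by apply/eqP; rewrite subn_eq0.
  by rewrite mulr0n big1 // => b _; rewrite raddf0.
have dW : (\det W)^`() = \sum_b coef_yderiv b b (\det W).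
  rewrite (derivation_det (D := @deriv _)); last exact: derivM.
  apply: eq_bigr => r _; rewrite coef_yderiv_det_pencil -det_set_row_delta.
  congr (\det _); apply/matrixP => i j; rewrite !mxE; case: ifP => // _.
  by rewrite /= derivD derivC addr0 derivMn derivX eq_sym.
rewrite cpoly_coef //; under eq_bigr do rewrite -coef_coef_yderiv.
rewrite -coef_sum -dW coef_deriv cpoly_coef ?(ltnW lt_kn) //.
by rewrite subnS prednK // subn_gt0.
Qed.

Lemma glpoly_eval_ymx X : map_mx (glpoly_eval X) Y = X.
Proof. by apply/matrixP => i j; rewrite !mxE /glpoly_eval mevalXU mxvecE. Qed.

Lemma glpoly_eval_cpoly_conj g h X k : h *m g = 1%:M ->
  glpoly_eval (g *m X *m h) (cpoly C n k) = glpoly_eval X (cpoly C n k).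
Proof.
move=> hg; have [lt_nk|le_kn] := ltnP n k; first by rewrite cpoly_gt // !rmorph0.
have evE Z : glpoly_eval Z (cpoly C n k) = (\det (pencil Z))`_(n - k).
  have detE : map_poly (glpoly_eval Z) (\det W) = \det (pencil Z).
    rewrite -[LHS]det_map_mx; congr (\det _).
    rewrite /pencil map_mxD map_scalar_mx /= map_polyX; congr (_ + _).
    by rewrite -[in RHS](glpoly_eval_ymx Z); apply/matrixP => i j; rewrite !mxE map_polyC.
  by rewrite cpoly_coef // -detE coef_map.
rewrite !evE; congr (_`_ _).
have hg' : map_mx polyC h *m map_mx polyC g = 1%:M by rewrite -map_mxM hg map_mx1.
have -> : pencil (g *m X *m h) = map_mx polyC g *m pencil X *m map_mx polyC h.
  rewrite /pencil mulmxDr mulmxDl -!map_mxM; congr (_ + _).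
  by rewrite mul_mx_scalar -scalemxAl (mulmx1C hg') scalemx1.
rewrite !det_mulmx mulrAC -det_mulmx (mulmx1C hg') det1 mul1r //.
Qed.

Lemma glpoly_eval_cgrad_conj g h X k : h *m g = 1%:M ->
  map_mx (glpoly_eval (g *m X *m h)) (cgrad k)
  = g *m map_mx (glpoly_eval X) (cgrad k) *m h.
Proof.
move=> hg; elim: k => [|k IH]; first by rewrite cgrad0 !map_mx0 mulmx0 mul0mx.
rewrite cgradS !map_mxB !map_mxM !map_scalar_mx IH !glpoly_eval_ymx.
rewrite /= glpoly_eval_cpoly_conj // mulmxBr mulmxBl; congr (_ - _).
  by rewrite mul_mx_scalar -scalemxAl (mulmx1C hg) scalemx1.
by rewrite !mulmxA -(mulmxA _ h g) hg mulmx1.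
Qed.

Lemma diag_restrict_ymx : map_mx (@diag_restrict C n) Y = diag_mx (\row_i 'X_i).
Proof.
apply/matrixP => i j; rewrite [LHS]mxE [Y _ _]mxE /diag_restrict /ycoord comp_mpolyXU.
by rewrite -tnth_nth tnth_mktuple mxvecE.
Qed.

Lemma diag_restrict_cpoly k : diag_restrict (cpoly C n k) = mesym n C k.
Proof.
rewrite cpoly_minor_sum [LHS]rmorph_sum; apply: eq_bigr => A _ /=.
rewrite -det_map_mx.
have -> : map_mx (@diag_restrict C n) (mask_rows A Y)
    = diag_mx (\row_i if i \in A then 'X_i else 1).
  apply/matrixP => i j; rewrite [LHS]mxE [mask_rows _ _ _ _]mxE.
  have := congr1 (fun M : 'M_n => M i j) diag_restrict_ymx; rewrite mxE => YE.
  by case: ifP => iA; rewrite ?YE ?rmorph_nat !mxE iA.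
rewrite det_diag [RHS]big_mkcond; apply: eq_bigr => i _.
by rewrite mxE.
Qed.

(** The recursion of [cgradS] on diagonal matrices. For k > 0, [gdiag k i] is the elementary
    symmetric polynomial of degree k - 1 in the variables other than t_i. *)
Fixpoint gdiag k : 'I_n -> {mpoly C[n]} :=
  if k is k'.+1 then fun i => mesym n C k' - 'X_i * gdiag k' i else fun=> 0.

Lemma diag_restrict_cgrad k :
  map_mx (@diag_restrict C n) (cgrad k) = diag_mx (\row_i gdiag k i).
Proof.
elim: k => [|k IH].
  by rewrite cgrad0 map_mx0; apply/matrixP => i j; rewrite !mxE mul0rn.
rewrite cgradS map_mxB map_mxM map_scalar_mx IH diag_restrict_ymx /= diag_restrict_cpoly.
rewrite mulmx_diag; apply/matrixP => i j; rewrite !mxE.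
by case: eqP => // _; rewrite ?mulr1n // !mulr0n subr0.
Qed.

End CharacteristicCoefficients.

(** * The representation on the symmetric power *)

Section SymmetricPowerAction.
Variables (C : numClosedFieldType) (n m : nat).
Implicit Types (g h X : 'M[C]_n) (p : {mpoly C[n]}).

Lemma der_mx_is_linear X : linear (der_mx X).
Proof.
move=> a p q; rewrite /der_mx scaler_sumr -big_split; apply: eq_bigr => i _ /=.
rewrite scaler_sumr -big_split; apply: eq_bigr => j _ /=.
rewrite mderivD mderivZ mulrDr scalerDr -scalerAr; congr (_ + _).
by rewrite !scalerA mulrC.
Qed.

HB.instance Definition _ X :=
  GRing.isLinear.Build C {mpoly C[n]} {mpoly C[n]} *:%R (der_mx X) (der_mx_is_linear X).

HB.instance Definition _ g :=
  GRing.Linear.copy (@subst_mx C n g)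
    (comp_mpoly [tuple \sum_(i < n) g i j *: 'X_i | j < n]).

Lemma der_mxM X p q : der_mx X (p * q) = der_mx X p * q + p * der_mx X q.
Proof.
rewrite /der_mx mulr_suml mulr_sumr -big_split; apply: eq_bigr => i _ /=.
rewrite mulr_suml mulr_sumr -big_split; apply: eq_bigr => j _ /=.
by rewrite mderivM -!scalerAl -!scalerAr -scalerDr; congr (_ *: _); ring.
Qed.

Lemma der_mxC X c : der_mx X c%:MP = 0.
Proof. by rewrite /der_mx !big1 // => i _; rewrite big1 // => j _; rewrite mderivC mulr0 scaler0. Qed.

Lemma der_mxXU X j : der_mx X 'X_j = \sum_i X i j *: 'X_i.
Proof.
rewrite /der_mx; apply: eq_bigr => i _; rewrite (bigD1 j) //= big1 ?addr0 => [|k /negPf neq_kj].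
  rewrite mderivX mnm1E eqxx scale1r (_ : (U_(j) - U_(j))%MM = 0%MM) ?mpolyX0 ?mulr1 //.
  by apply/mnmP => k; rewrite mnmBE subnn mnm0E.
by rewrite mderivX mnm1E eq_sym neq_kj scale0r mulr0 scaler0.
Qed.

Lemma der_mx_delta a b p : der_mx (delta_mx a b) p = 'X_a * p^`M(b).
Proof.
rewrite /der_mx (bigD1 a) //= (bigD1 b) //= mxE !eqxx scale1r !big1 ?addr0 //.
  by move=> i /negPf neq_i; rewrite big1 // => j _; rewrite mxE neq_i scale0r.
by move=> j /negPf neq_j; rewrite mxE neq_j andbF scale0r.
Qed.

Lemma der_mx_homog X d a : mdeg a = d -> der_mx X 'X_[a] \is d.-homog.
Proof.
move=> <-; apply: rpred_sum => i _; apply: rpred_sum => j _; apply: rpredZ.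
rewrite mderivX -scalerAr; have [->|aj] := posnP (a j); first by rewrite scale0r rpred0.
apply: rpredZ; have le_a : (U_(j) <= a)%MM by rewrite lep1mP -lt0n.
rewrite -mpolyXD dhomogX; apply/eqP => /=.
by rewrite -[in RHS](submK le_a) !mdegD !mdeg1 addnC.
Qed.

Lemma mdeg_symmon (b : 'I_(symdim n m)) : mdeg (symmon b) = m.
Proof. exact/eqP/(valP (enum_val b)). Qed.

Lemma symmx_mul_der (f : {linear {mpoly C[n]} -> {mpoly C[n]}}) X :
  symmx m f *m dpi m X = symmx m (f \o der_mx X).
Proof. by rewrite /dpi symmx_mul // => b; apply: der_mx_homog; exact: mdeg_symmon. Qed.

(** By the chain rule it suffices to compare the two sides on the variables, where the claim is the
    hypothesis [Z *m g = g *m X] read entrywise. *)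
Lemma der_subst_mx Z g X p : Z *m g = g *m X ->
  der_mx Z (subst_mx g p) = subst_mx g (der_mx X p).
Proof.
move=> Zg.
pose h j : {mpoly C[n]} := tnth [tuple \sum_(i < n) g i j *: 'X_i | j < n] j.
have hE j : h j = \sum_(i < n) g i j *: 'X_i by rewrite /h tnth_mktuple.
have -> : der_mx Z (subst_mx g p) = \sum_k subst_mx g p^`M(k) * der_mx Z (h k).
  apply: (@mmap_chain _ _ _ (der_mx Z) (@mpolyC n C) h p); first exact: der_mxM.
  by move=> a; exact: der_mxC.
have -> : subst_mx g (der_mx X p) = \sum_j subst_mx g p^`M(j) * \sum_i X i j *: h i.
  rewrite /der_mx raddf_sum (eq_bigr (fun i => \sum_j subst_mx g p^`M(j) * (X i j *: h i))).
    by rewrite exchange_big; apply: eq_bigr => j _; rewrite mulr_sumr.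
  move=> i _; rewrite raddf_sum; apply: eq_bigr => j _ /=.
  rewrite linearZ /= /subst_mx rmorphM /= comp_mpolyXU -tnth_nth.
  by rewrite mulrC -scalerAr.
apply: eq_bigr => j _; congr (_ * _); rewrite hE raddf_sum.
rewrite (eq_bigr (fun k => \sum_i (Z i k * g k j) *: 'X_i)); last first.
  move=> k _; rewrite /= linearZ /= der_mxXU scaler_sumr; apply: eq_bigr => i _.
  by rewrite scalerA mulrC.
rewrite exchange_big (eq_bigr (fun i => (g *m X) i j *: 'X_i)); last first.
  by move=> i _; rewrite -Zg mxE scaler_suml.
under [RHS]eq_bigr do rewrite hE scaler_sumr.
rewrite exchange_big; apply: eq_bigr => i _; rewrite mxE scaler_suml.
by apply: eq_bigr => k _; rewrite scalerA mulrC.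
Qed.

Lemma dpi_conj g h X : h *m g = 1%:M ->
  dpi m (g *m X *m h) = rho m g *m dpi m X *m rho m h.
Proof.
move=> hg; suff E : dpi m (g *m X *m h) *m rho m g = rho m g *m dpi m X.
  by rewrite -E -(mulmxA _ (rho m g)) -rho_mul (mulmx1C hg) rho1 mulmx1.
rewrite {1}/rho {1}/dpi symmx_mul; last first.
  by move=> b; apply: subst_mx_homog; exact: mdeg_symmon.
rewrite symmx_mul_der; apply/matrixP => a b; rewrite !mxE /=.
by rewrite (der_subst_mx (X := X)) // -!mulmxA hg mulmx1.
Qed.

Lemma dpi_delta_sum X : dpi m X = \sum_i \sum_j X i j *: dpi m (delta_mx i j).
Proof.
apply/matrixP => a b; rewrite mxE summxE raddf_sum; apply: eq_bigr => i _.
rewrite raddf_sum summxE; apply: eq_bigr => j _.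
by rewrite !mxE /= mcoeffZ der_mx_delta.
Qed.

(** The normally ordered operator x_a x_i d_b d_j, which is the quadratic part of a product of two
    operators x_a d_b and x_i d_j. *)
Definition dpi2 a i b j : 'M[C]_(symdim n m) :=
  symmx m (fun p => 'X_a * 'X_i * p^`M(j)^`M(b)).

Lemma dpi2C a i b j : dpi2 a i b j = dpi2 i a b j.
Proof. by apply/matrixP => r s; rewrite !mxE [X in X * _]mulrC. Qed.

Lemma dpi_delta_mul a b i j :
  dpi m (delta_mx a b) *m dpi m (delta_mx i j)
  = dpi2 a i b j + (b == i)%:R *: dpi m (delta_mx a j).
Proof.
rewrite {1}/dpi symmx_mul_der; apply/matrixP => r s; rewrite !mxE /=.
rewrite !der_mx_delta mderivM mulrDr mcoeffD addrC mulrA; congr (_ + _).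
rewrite mderivX mnm1E eq_sym; case: eqP => [->|_]; last by rewrite scale0r !mul0r mulr0 mcoeff0.
rewrite scale1r (_ : (U_(i) - U_(i))%MM = 0%MM) ?mpolyX0 ?mul1r //.
by apply/mnmP => k; rewrite mnmBE subnn mnm0E.
Qed.

Lemma dpi_delta_diag (i : 'I_n) :
  dpi m (delta_mx i i) = diag_mx (\row_(b < symdim n m) (symmon b i)%:R) :> 'M[C]__.
Proof.
apply/matrixP => a b; rewrite !mxE der_mx_delta mderivX -scalerAr mcoeffZ.
have [bi0|bi] := posnP (symmon b i).
  rewrite bi0 mul0r; case: eqP => [->|_]; last by rewrite mulr0n.
  by rewrite bi0 mul0rn.
have le_b : (U_(i) <= symmon b)%MM by rewrite lep1mP -lt0n.
rewrite -mpolyXD addmC submK // mcoeffX.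
have -> : (symmon b == symmon a) = (a == b).
  apply/eqP/eqP => [eq_ab|-> //].
  by apply: enum_val_inj; apply/val_inj/val_inj.
by case: eqP => [->|_]; rewrite ?mulr1 ?mulr0.
Qed.

End SymmetricPowerAction.

(** * The Kirillov-Wei operator *)

Section KirillovWei.
Variables (C : numClosedFieldType) (n m : nat).
Local Notation S := {mpoly C[n * n]}.
Local Notation polymap := 'M[S]_(symdim n m).
Local Notation mpC := (map_mx (@mpolyC (n * n) C)).
Implicit Types (G : 'M[S]_n) (F : polymap).

(** The extension of [dpi] to matrices of polynomials, linear over S: the map Y |-> pi(G(Y)). *)
Definition pi_map G : polymap := \sum_i \sum_j G i j *: mpC (dpi m (delta_mx i j)).

Lemma pi_map0 : pi_map 0 = 0.
Proof. by rewrite /pi_map !big1 // => i _; rewrite big1 // => j _; rewrite mxE scale0r. Qed.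

Lemma yderivZ i j (c d : S) : (forall k l, yderiv k l c = 0) ->
  yderiv i j (c * d) = c * yderiv i j d.
Proof. by move=> c0; rewrite yderivM c0 mul0r add0r. Qed.

Lemma map_yderivZ i j (c : C) F :
  map_mx (yderiv i j) (c%:MP *: F) = c%:MP *: map_mx (yderiv i j) F.
Proof.
by apply/matrixP => a b; rewrite !mxE yderivZ // => k l; rewrite yderivC.
Qed.

Lemma kirillov_weiZ (c : C) F : kirillov_wei (c%:MP *: F) = c%:MP *: kirillov_wei F.
Proof.
rewrite /kirillov_wei scaler_sumr; apply: eq_bigr => i _.
rewrite scaler_sumr; apply: eq_bigr => j _.
by rewrite [X in X *m _]map_yderivZ scalemxAl.
Qed.

Lemma kirillov_wei_scalar c :
  kirillov_wei c%:M = pi_map (\matrix_(i, j) yderiv j i c).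
Proof.
apply: eq_bigr => i _; apply: eq_bigr => j _.
rewrite mxE -mul_scalar_mx; congr (_ *m _).
by apply/matrixP => a b; rewrite !mxE raddfMn.
Qed.

Lemma kirillov_wei_cpoly k : kirillov_wei (cpoly C n k)%:M = pi_map (cgrad C n k).
Proof. exact: kirillov_wei_scalar. Qed.

Lemma polymap_eval_pi_map X G :
  polymap_eval X (pi_map G) = dpi m (map_mx (glpoly_eval X) G).
Proof.
rewrite /polymap_eval /pi_map raddf_sum dpi_delta_sum; apply: eq_bigr => i _ /=.
rewrite raddf_sum; apply: eq_bigr => j _ /=; apply/matrixP => a b.
by rewrite !mxE rmorphM /= [glpoly_eval X _%:MP]mevalC.
Qed.

Lemma map_yderiv_pi_map i j G :
  map_mx (yderiv i j) (pi_map G) = pi_map (map_mx (yderiv i j) G).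
Proof.
apply/matrixP => r s; rewrite mxE /pi_map !summxE raddf_sum; apply: eq_bigr => a _ /=.
rewrite !summxE raddf_sum; apply: eq_bigr => b _ /=.
by rewrite !mxE mulrC yderivZ 1?mulrC // => k l; rewrite yderivC.
Qed.

(* The part of D(pi(grad c)) that is quadratic in the x's and in the d/dx's
   vanishes by antisymmetry of the second derivatives of minors. *)
Lemma kirillov_wei_pi_cgrad k :
  kirillov_wei (pi_map (cgrad C n k.+1))
  = (- (n - k)%:R : C)%:MP *: pi_map (cgrad C n k).
Proof.
pose H a b i j := yderiv j i (yderiv b a (cpoly C n k.+1)).
have antisym a b i j : H a b i j = - H i b a j by exact: cpoly_yderiv2_antisym.
pose T := \sum_i \sum_j \sum_a \sum_b H a b i j *: mpC (dpi2 C m a i b j).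
have T0 : T = 0.
  (* Exchanging the summation indices [a] and [i] fixes [dpi2] and changes the sign of [H]. *)
  have TN : T = - T.
    rewrite {1}/T exchange_big /=.
    rewrite (eq_bigr (fun j => \sum_a \sum_i \sum_b H a b i j *: mpC (dpi2 C m a i b j))).
      rewrite exchange_big /= -sumrN; apply: eq_bigr => a _; rewrite -sumrN.
      apply: eq_bigr => j _; rewrite -sumrN; apply: eq_bigr => i _; rewrite -sumrN.
      by apply: eq_bigr => b _; rewrite antisym dpi2C scaleNr.
    by move=> j _; rewrite exchange_big.
  apply/matrixP => r s; have /matrixP/(_ r s) := TN; rewrite !mxE => /eqP.
  rewrite -subr_eq0 opprK -mulr2n => /eqP Trs; apply/mpolyP => e.
  have := congr1 (mcoeff e) Trs; rewrite mcoeffMn !mcoeff0 => /eqP.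
  by rewrite mulrn_eq0 => /eqP.
transitivity (T + \sum_i \sum_j \sum_a \sum_b
    ((b == i)%:R * H a b i j) *: mpC (dpi m (delta_mx a j))).
  rewrite /T /kirillov_wei -big_split; apply: eq_bigr => i _ /=.
  rewrite -big_split; apply: eq_bigr => j _ /=.
  rewrite [X in X *m _]map_yderiv_pi_map /pi_map mulmx_suml -big_split.
  apply: eq_bigr => a _; rewrite mulmx_suml -big_split; apply: eq_bigr => b _ /=.
  rewrite -scalemxAl -map_mxM dpi_delta_mul map_mxD map_mxZ scalerDr scalerA.
  rewrite [X in _ + _ *: _ = X](_ : _ = H a b i j *: mpC (dpi2 C m a i b j) +
    (H a b i j * (b == i)%:R) *: mpC (dpi m (delta_mx a j))); last by rewrite [X in _ + X *: _]mulrC.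
  by rewrite /= mpolyC_nat !mxE.
rewrite T0 add0r /pi_map scaler_sumr.
(* The Kronecker delta leaves i = b. Antisymmetry then turns the sum over [b] into minus a
   derivative of the trace computed in [cpoly_yderiv_trace]. *)
transitivity (\sum_j \sum_a \sum_b H a b b j *: mpC (dpi m (delta_mx a j))).
  rewrite exchange_big; apply: eq_bigr => j _ /=; rewrite exchange_big; apply: eq_bigr => a _ /=.
  rewrite exchange_big; apply: eq_bigr => b _ /=.
  rewrite (bigD1 b) //= eqxx mul1r big1 ?addr0 // => i /negPf neq_ib.
  by rewrite eq_sym neq_ib mul0r scale0r.
rewrite exchange_big; apply: eq_bigr => a _ /=; rewrite scaler_sumr; apply: eq_bigr => j _ /=.
rewrite -scaler_suml scalerA mxE; congr (_ *: _).
under eq_bigr do rewrite antisym.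
rewrite sumrN -raddf_sum /= cpoly_yderiv_trace raddfMn /= mpolyCN mpolyC_nat.
by rewrite mulNr mulr_natl.
Qed.

Lemma iter_kirillov_wei_cpoly p q : exists c : C,
  iter q.+1 (@kirillov_wei C n m) (cpoly C n (p + q.+1))%:M
  = c%:MP *: pi_map (cgrad C n p.+1).
Proof.
elim: q p => [|q IH] p; first by exists 1; rewrite mpolyC1 scale1r addn1 [LHS]kirillov_wei_cpoly.
have [c cE] := IH p.+1; exists (c * - (n - p.+1)%:R).
rewrite iterS -addSnnS cE kirillov_weiZ kirillov_wei_pi_cgrad scalerA.
by rewrite mpolyCM.
Qed.

Lemma GL_equivariant_cpoly k : GL_equivariant ((cpoly C n k)%:M : polymap).
Proof.
move=> g X g_unit; rewrite /polymap_eval !map_scalar_mx /= glpoly_eval_cpoly_conj ?mulVmx //.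
by rewrite mul_mx_scalar -scalemxAl -rho_mul mulmxV // rho1 scalemx1.
Qed.

Lemma GL_equivariant_pi_cgrad k : GL_equivariant (pi_map (cgrad C n k)).
Proof.
move=> g X g_unit; have gV : invmx g *m g = 1%:M by rewrite mulVmx.
by rewrite !polymap_eval_pi_map glpoly_eval_cgrad_conj // dpi_conj.
Qed.

Lemma diag_restrict_pi_map G (d : 'I_n -> {mpoly C[n]}) :
    map_mx (@diag_restrict C n) G = diag_mx (\row_i d i) ->
  map_mx (@diag_restrict C n) (pi_map G)
  = diag_mx (\row_(b < symdim n m) \sum_i d i *+ symmon b i).
Proof.
move=> GE; have GijE i j : diag_restrict (G i j) = d i *+ (i == j).
  by have /matrixP/(_ i j) := GE; rewrite !mxE.
transitivity (\sum_i d i *: map_mx (@mpolyC n C) (dpi m (delta_mx i i))).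
  apply/matrixP => r s; rewrite mxE /pi_map !summxE raddf_sum; apply: eq_bigr => i _.
  rewrite /= summxE raddf_sum (bigD1 i) //= big1 ?addr0 => [|j neq_ji].
    by rewrite mxE rmorphM /= GijE eqxx mulr1n !mxE [diag_restrict _%:MP]comp_mpolyC.
  by rewrite mxE rmorphM /= GijE eq_sym (negPf neq_ji) mulr0n mul0r.
apply/matrixP => r s; rewrite summxE !mxE -sumrMnl; apply: eq_bigr => i _.
rewrite !mxE -/(dpi m (delta_mx i i)).
have := dpi_delta_diag C m i => /matrixP/(_ r s); rewrite !mxE => ->.
by rewrite mpolyCMn mpolyC_nat mulrnAr mulr_natr.
Qed.

End KirillovWei.

(** * Restriction to diagonal matrices is injective *)

Section PolynomialIdentity.
Variables (C : numClosedFieldType).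

Lemma poly_vanishing (p : {poly C}) : (forall s, p.[s] = 0) -> p = 0.
Proof.
move=> p0; apply/eqP; apply: contraT => p_neq0.
have := @max_poly_roots _ p [seq k%:R | k <- iota 0 (size p)] p_neq0.
rewrite size_map size_iota ltnn; apply; first by apply/allP => x _; rewrite rootE p0.
by rewrite map_inj_uniq ?iota_uniq // => k l /eqP; rewrite eqr_nat => /eqP.
Qed.

(** Restricted to the line through [v] parallel to the i-th axis, [p] is a polynomial in one
    variable with all values 0, hence zero; its derivative at 0 is the value sought. *)
Lemma mderiv_vanishing N (p : {mpoly C[N]}) i : (forall v, p.@[v] = 0) ->
  forall v, p^`M(i).@[v] = 0.
Proof.
move=> p0 v; pose h j : {poly C} := (v j)%:P + (i == j)%:R *: 'X.
have q0 : mmap polyC h p = 0.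
  apply: poly_vanishing => s; rewrite -[LHS]/(horner_eval s _) rmorph_mmap.
  rewrite -[RHS](p0 (fun j => (h j).[s])); apply: eq_mmap => [a|//].
  by rewrite /= /horner_eval hornerC.
have := congr1 (fun q : {poly C} => q^`().[0]) q0.
rewrite (@mmap_chain _ _ _ (@deriv C)); [|exact: derivM|exact: derivC].
rewrite deriv0 horner0 horner_sum (bigD1 i) //= big1 ?addr0 => [|k /negPf neq_ki].
  rewrite hornerM derivD derivC add0r derivZ derivX eqxx scale1r hornerC mulr1 => <-.
  rewrite -[RHS]/(horner_eval 0 _) rmorph_mmap; apply: eq_mmap => [a|j].
    by rewrite /= /horner_eval hornerC.
  by rewrite /= /horner_eval hornerD hornerC hornerZ hornerX mulr0 addr0.
by rewrite derivD derivC add0r derivZ derivX eq_sym neq_ki scale0r mulr0 horner0.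
Qed.

(* The coefficients are, up to factorials, the values at 0 of the iterated
   derivatives. *)
Lemma mpoly_vanishing N (p : {mpoly C[N]}) : (forall v, p.@[v] = 0) -> p = 0.
Proof.
move=> p0; apply/mpolyP => a.
have da v : p^`M[a].@[v] = 0.
  rewrite mderivm_foldr; elim: (flatten _) v => //= i s IH v.
  exact: mderiv_vanishing.
have eval0 (q : {mpoly C[N]}) : q.@[fun=> 0] = q@_0.
  rewrite mevalE [in RHS](mpolyE q) [RHS]raddf_sum /=.
  apply: eq_bigr => b _; rewrite mcoeffZ mcoeffX; congr (_ * _).
  have [->|b_neq0] := eqVneq b 0%MM.
    by rewrite big1 // => i _; rewrite mnm0E.
  have [i bi] : exists i, b i != 0%N.
    apply/existsP; apply: contraR b_neq0 => /existsPn b0; apply/eqP/mnmP => i.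
    by rewrite mnm0E; apply/eqP; have := b0 i; rewrite negbK.
  by rewrite (bigD1 i) //= expr0n (negPf bi) mul0r.
have := da (fun=> 0); rewrite eval0 mcoeff_mderivm addm0 mcoeff0 => /eqP.
rewrite mulrn_eq0 => /orP[|/eqP //].
rewrite -leqn0 leqNgt prodn_gt0 // => i.
by rewrite ffactnn fact_gt0.
Qed.

End PolynomialIdentity.

(** * Equivariant maps are determined by their restriction to diagonal matrices *)

Section EquivariantMaps.
Variables (C : numClosedFieldType) (n m : nat).
Implicit Types (F : 'M[{mpoly C[n.+1 * n.+1]}]_(symdim n.+1 m)) (X P : 'M[C]_n.+1).

(** The minimal polynomial divides the characteristic polynomial, which here is a product of
    distinct linear factors. *)
Lemma diagonalizable_trig X : is_trig_mx X -> injective (fun i => X i i) ->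
  exists2 P, P \in unitmx & exists d, X = invmx P *m diag_mx d *m P.
Proof.
move=> X_trig X_inj.
have /diagonalizableP[P P_unit /diagonalizable_forPex[d /(simmxLR P_unit) XE]] :
    exists2 rs, uniq rs & mxminpoly X %| \prod_(x <- rs) ('X - x%:P).
  exists [seq X i i | i <- enum 'I_n.+1]; first by rewrite map_inj_uniq ?enum_uniq.
  rewrite big_map big_enum /= -char_poly_trig //; exact: mxminpoly_dvd_char.
by exists P => //; exists d; rewrite -conjVmx.
Qed.

(** Vanishing spreads from diagonal matrices to triangular ones with distinct diagonal entries by
    conjugation, then to all triangular ones by a one-parameter perturbation, and to all matrices by
    Schur triangularization. *)
Lemma GL_equivariant_vanishing F :
  GL_equivariant F -> map_mx (@diag_restrict C n.+1) F = 0 -> F = 0.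
Proof.
move=> F_eq F0.
have diag0 d : polymap_eval (diag_mx d) F = 0.
  apply/matrixP => a b; rewrite [RHS]mxE [LHS]mxE.
  have : (diag_restrict (F a b)).@[fun i => d 0 i] = 0.
    by have /matrixP/(_ a b) := F0; rewrite !mxE => ->; rewrite meval0.
  rewrite /diag_restrict comp_mpoly_meval => <-; apply: meval_eq => k.
  rewrite tnth_mktuple; case/mxvec_indexP: k => i j; rewrite !mxvecE !mxE.
  by rewrite mevalMn mevalXU.
have conj0 P X : P \in unitmx -> polymap_eval X F = 0 ->
    polymap_eval (invmx P *m X *m P) F = 0.
  move=> P_unit X0; rewrite -[in X in _ *m X](invmxK P) F_eq ?unitmx_inv //.
  by rewrite X0 mulmx0 mul0mx.
have trig_inj0 X : is_trig_mx X -> injective (fun i => X i i) -> polymap_eval X F = 0.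
  by move=> X_trig /(diagonalizable_trig X_trig)[P P_unit [d ->]]; apply: conj0.
have trig0 X : is_trig_mx X -> polymap_eval X F = 0.
  move=> X_trig; apply/matrixP => a b; rewrite [LHS]mxE [RHS]mxE.
  (* The entries of [D] are distinct, so [X + s *: D] has distinct diagonal entries unless [s] is a
     root of the nonzero polynomial [B]. Hence q B vanishes everywhere, and q = 0. *)
  pose D : 'M[C]_n.+1 := diag_mx (\row_i i%:R).
  pose Z : 'M[{poly C}]_n.+1 := map_mx polyC X + 'X *: map_mx polyC D.
  pose q := mmap polyC (fun k => mxvec Z 0 k) (F a b).
  pose B : {poly C} := \prod_(i < n.+1) \prod_(j < n.+1 | j != i) (Z i i - Z j j).
  have qE s : q.[s] = glpoly_eval (X + s *: D) (F a b).
    rewrite -[LHS]/(horner_eval s q) /q rmorph_mmap; apply: eq_mmap => [x|k].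
      by rewrite /= /horner_eval hornerC.
    rewrite /=; case/mxvec_indexP: k => i j; rewrite !mxvecE !mxE /horner_eval.
    by rewrite hornerD hornerM hornerX !hornerC.
  have ZE i s : (Z i i).[s] = (X + s *: D) i i.
    by rewrite !mxE hornerD hornerM hornerX !hornerC.
  have B_neq0 : B != 0.
    apply/prodf_neq0 => i _; apply/prodf_neq0 => j neq_ji.
    apply: contra neq_ji => /eqP Zij.
    have := congr1 (fun p : {poly C} => p`_1) Zij.
    rewrite !mxE !eqxx !mulr1n coefB !coefD !coefC /= !coefXM /= !coefC /= ?coef0 !add0r.
    by move/eqP; rewrite subr_eq0 eqr_nat => /eqP/ord_inj ->.
  have qB0 : q * B = 0.
    apply: poly_vanishing => s; rewrite hornerM qE.
    have [XsD_inj|] := boolP (injectiveb (fun i => (X + s *: D) i i)).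
      have /matrixP/(_ a b) : polymap_eval (X + s *: D) F = 0.
        apply: trig_inj0; last exact/injectiveP.
        apply/is_trig_mxP => i j lt_ij; rewrite !mxE (is_trig_mxP X_trig) //.
        by rewrite -val_eqE ltn_eqF // mulr0n mulr0 addr0.
      by rewrite [in X in X -> _]mxE [in X in X -> _]mxE => ->; rewrite mul0r.
    case/injectivePn => i [j neq_ij eq_ij].
    rewrite horner_prod (bigD1 i) //= horner_prod (bigD1 j) /=; last by rewrite eq_sym.
    by rewrite hornerD hornerN !ZE eq_ij subrr !mul0r mulr0.
  have q0 : q = 0 by move/eqP: qB0; rewrite mulf_eq0 (negPf B_neq0) orbF => /eqP.
  by have := qE 0; rewrite q0 horner0 scale0r addr0.
have eval0 X : polymap_eval X F = 0.
  have [P /unitarymx_unit P_unit PX] := Schur X (ltn0Sn n).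
  have -> : X = invmx P *m (P *m X *m invmx P) *m P.
    by rewrite !mulmxA mulVmx // mul1mx -mulmxA mulVmx // mulmx1.
  apply: conj0 => //; apply: trig0; rewrite -conjumx //; exact: PX.
apply/matrixP => a b; rewrite [RHS]mxE; apply: mpoly_vanishing => v.
have := eval0 (vec_mx (\row_k v k)) => /matrixP/(_ a b); rewrite [LHS]mxE [RHS]mxE => <-.
by apply: meval_eq => k; rewrite vec_mxK mxE.
Qed.

End EquivariantMaps.

Lemma coef_lowM (K : comNzRingType) (p q : {poly K}) d :
  (forall k, (k < d)%N -> p`_k = 0) -> (p * q)`_d = p`_d * q`_0.
Proof.
move=> p0; rewrite coefM big_ord_recr /= subnn big1 ?add0r // => k _.
by rewrite p0 ?mul0r.
Qed.

(** * Invariant polynomials are determined by their restriction to diagonal matrices *)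

Section InvariantPolynomials.
Variables (C : numClosedFieldType) (n : nat).
Local Notation S := {mpoly C[n * n]}.
Local Notation Y := (ymx C n).

(** The off-diagonal coordinates are multiplied by a parameter 'X, whose powers then record the
    degree of a polynomial in these coordinates. *)
Definition scaled_ymx : 'M[{poly S}]_n :=
  \matrix_(i, j) ((Y i j)%:P * (if i == j then 1 else 'X)).

Definition offdiag_scale : S -> {poly S} :=
  mmap (polyC \o @mpolyC (n * n) C) (fun k => mxvec scaled_ymx 0 k).

HB.instance Definition _ := GRing.RMorphism.copy offdiag_scale
  (mmap (polyC \o @mpolyC (n * n) C) (fun k => mxvec scaled_ymx 0 k)).

Lemma offdiag_scale_ymx : map_mx offdiag_scale Y = scaled_ymx.
Proof. by apply/matrixP => i j; rewrite mxE [Y i j]mxE [LHS]mmapX mmap1U mxvecE. Qed.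

Lemma mmap_chain_mx (D : {additive {poly S} -> {poly S}}) c :
    (forall x y, D (x * y) = D x * y + x * D y) ->
    (forall a : C, D (a%:MP)%:P = 0) ->
  D (offdiag_scale c) = \sum_i \sum_j offdiag_scale (yderiv i j c) * D (scaled_ymx i j).
Proof.
move=> DM DC; rewrite /offdiag_scale (@mmap_chain _ _ _ D) //.
rewrite (reindex _ (curry_mxvec_bij n n)) pair_bigA /=.
by apply: eq_bigr => -[i j] _ /=; rewrite mxvecE.
Qed.

Lemma coef_yderiv_offdiag_scale i j c :
  coef_yderiv i j (offdiag_scale c)
  = offdiag_scale (yderiv i j c) * (if i == j then 1 else 'X).
Proof.
have chain := @mmap_chain_mx (coef_yderiv i j) c (coef_yderivM i j).
rewrite [LHS]chain => [|a]; last by rewrite [LHS]coef_yderiv_polyC yderivC.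
have entry a b : coef_yderiv i j (scaled_ymx a b)
    = if (a == i) && (b == j) then (if i == j then 1 else 'X) else 0.
  rewrite mxE coef_yderivM coef_yderiv_polyC yderiv_ymx [X in _ + X](_ : _ = 0); last first.
    rewrite (_ : coef_yderiv i j _ = 0) ?mulr0 //.
    case: eqP => _; first by rewrite -[1]/(1%:R) coef_yderiv_nat.
    by apply/polyP => k; rewrite coef_coef_yderiv coefX coef0 -mpolyC_nat yderivC.
  by case: andP => [[/eqP -> /eqP ->]|_]; rewrite addr0 ?mul1r ?mul0r.
rewrite (bigD1 i) //= (bigD1 j) //= entry !eqxx big1 => [|b /negPf neq_b].
  rewrite big1 ?addr0 // => a /negPf neq_a; rewrite big1 // => b _.
  by rewrite entry neq_a mulr0.
by rewrite entry neq_b andbF mulr0.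
Qed.

Lemma ymx_diag_neq a b : a != b -> Y a a - Y b b != 0.
Proof.
move=> neq_ab; apply/eqP => /(congr1 (yderiv a a)).
rewrite raddfB /= !yderiv_ymx !eqxx eq_sym (negPf neq_ab) subr0 raddf0.
by move/eqP; rewrite oner_eq0.
Qed.

(* Let c_d be the lowest-order part of c in the off-diagonal coordinates. The
   lowest-order part of the invariance under E_ab is
   (y_aa - y_bb) d c_d / d y_ab = 0, so that c_d only involves the diagonal
   coordinates. *)
Lemma gl_invariant_vanishing (c : S) :
  gl_invariant c -> @diag_restrict C n c = 0 -> c = 0.
Proof.
move=> c_inv c0; pose q := offdiag_scale c.
(* The value 1 of the parameter recovers [c] from [q]. *)
have [q0|q_neq0] := eqVneq q 0.
  have : (q.[1] : S) = 0 by rewrite q0 horner0.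
  rewrite -[LHS]/(horner_eval 1 q) /q /offdiag_scale rmorph_mmap => <-.
  rewrite -[LHS]comp_mpoly_id; apply: eq_mmap => [a|k].
    by rewrite /= /horner_eval hornerC.
  rewrite tnth_mktuple /=; case/mxvec_indexP: k => i j; rewrite mxvecE !mxE /horner_eval.
  by rewrite hornerM hornerC; case: eqP; rewrite ?hornerX ?hornerC mulr1.
have [d qd_neq0 d_min] : exists2 d, q`_d != 0 & forall k, (k < d)%N -> q`_k = 0.
  have ex_d : exists d, q`_d != 0 by exists (size q).-1; rewrite -lead_coefE lead_coef_eq0.
  case: (ex_minnP ex_d) => d qd_neq0 d_min; exists d => // k.
  by rewrite ltnNge => lt_kd; apply/eqP; apply: contraR lt_kd => /d_min.
have dq_low i j k : (k < d)%N -> (coef_yderiv i j q)`_k = 0.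
  by move=> /d_min qk; rewrite coef_coef_yderiv qk raddf0.
have dqd a b : a != b -> yderiv a b q`_d = 0.
  move=> neq_ab; pose E : 'M[S]_n := delta_mx a b.
  (* The factor 'X compensates the one produced by the chain rule for i != j, so that every term
     contains a derivative of [q] itself. *)
  have := congr1 (fun r => 'X * offdiag_scale r) (c_inv (delta_mx a b)).
  rewrite rmorph0 mulr0 /gl_act rmorph_sum mulr_sumr.
  rewrite (eq_bigr (fun i => \sum_j (if i == j then 'X else 1) * coef_yderiv i j q *
      (scaled_ymx *m map_mx polyC E - map_mx polyC E *m scaled_ymx) i j)); last first.
    move=> i _; rewrite rmorph_sum mulr_sumr; apply: eq_bigr => j _ /=.
    rewrite rmorphM /= mulrA coef_yderiv_offdiag_scale.
    have -> : offdiag_scale ((Y *m map_mx (@mpolyC _ _) (delta_mx a b)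
         - map_mx (@mpolyC _ _) (delta_mx a b) *m Y) i j)
       = (scaled_ymx *m map_mx polyC E - map_mx polyC E *m scaled_ymx) i j.
      rewrite -offdiag_scale_ymx.
      have -> : map_mx polyC E = map_mx offdiag_scale (map_mx (@mpolyC _ _) (delta_mx a b)).
        by rewrite /E !map_delta_mx.
      by rewrite -!map_mxM -map_mxB [RHS]mxE.
    by congr (_ * _); case: eqP => _; ring.
  move/(congr1 (fun r : {poly S} => r`_d)); rewrite coef0 coef_sum.
  rewrite (bigD1 a) //= coef_sum (bigD1 b) //= (negPf neq_ab) mul1r.
  have scaled0 i j : (scaled_ymx i j)`_0 = Y i j *+ (i == j).
    by rewrite mxE coefCM; case: eqP => _; rewrite ?coefX ?coef1 ?mulr1 ?mulr0.
  have B0 i j : ((scaled_ymx *m map_mx polyC E - map_mx polyC E *m scaled_ymx) i j)`_0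
      = (Y a a - Y b b) *+ ((i == a) && (j == b)).
    rewrite /E map_delta_mx mxE [X in _ + X]mxE coefB.
    have -> : (scaled_ymx *m delta_mx a b) i j = scaled_ymx i a *+ (j == b).
      rewrite mxE (bigD1 a) //= big1 ?addr0 => [|k /negPf neq_k]; rewrite [delta_mx _ _ _ _]mxE.
        by rewrite eqxx mulr_natr.
      by rewrite neq_k mulr0.
    have -> : (delta_mx a b *m scaled_ymx) i j = scaled_ymx b j *+ (i == a).
      rewrite mxE (bigD1 b) //= big1 ?addr0 => [|k /negPf neq_k]; rewrite [delta_mx _ _ _ _]mxE.
        by rewrite eqxx andbT mulr_natl.
      by rewrite neq_k andbF mul0r.
    rewrite !coefMn !scaled0; case: (eqVneq i a) => [->|_].
      rewrite mulr1n [b == j]eq_sym; case: (eqVneq j b) => [->|_]; by rewrite ?mulr1n ?mulr0n ?subr0.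
    by rewrite !mulr0n mul0rn subr0.
  rewrite (coef_lowM (p := coef_yderiv a b q)); last exact: dq_low.
  rewrite B0 !eqxx mulr1n big1 ?addr0 => [|j /negPf neq_j]; last first.
    case: eqP => _; last by rewrite mul1r coef_lowM; [rewrite B0 neq_j andbF mulr0 | exact: dq_low].
    rewrite -mulrA coefXM; case: (d) dq_low => // d' low /=.
    by rewrite coef_lowM ?low ?mul0r // => k lt_k; apply: low; exact: ltnW.
  rewrite big1 ?addr0 => [|i /negPf neq_i]; last first.
    rewrite coef_sum big1 // => j _.
    case: eqP => _; last by rewrite mul1r coef_lowM; [rewrite B0 neq_i mulr0 | exact: dq_low].
    rewrite -mulrA coefXM; case: (d) dq_low => // d' low /=.
    by rewrite coef_lowM ?low ?mul0r // => k lt_k; apply: low; exact: ltnW.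
  rewrite coef_coef_yderiv => /eqP; rewrite mulf_eq0 => /orP[/eqP //|].
  by rewrite (negPf (ymx_diag_neq neq_ab)).
have d0 : d = 0%N.
  (* Euler's identity for the off-diagonal degree: in degree [d] it reads d q_d = 0, as all the
     off-diagonal derivatives of q_d vanish. *)
  have euler : 'X * q^`() = \sum_i \sum_j (if i == j then 0 else (Y i j)%:P * coef_yderiv i j q).
    rewrite /q (@mmap_chain_mx (@deriv S)); [|exact: derivM|by move=> a; exact: derivC].
    rewrite mulr_sumr; apply: eq_bigr => i _; rewrite mulr_sumr; apply: eq_bigr => j _.
    rewrite mxE /= derivM derivC mul0r add0r coef_yderiv_offdiag_scale.
    by case: eqP => _; rewrite ?derivX -?[1]/(1%:P) ?derivC; ring.
  have := congr1 (fun r : {poly S} => r`_d) euler.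
  rewrite coefXM coef_sum big1 => [|i _]; last first.
    rewrite coef_sum big1 // => j _; case: eqP => [_|/eqP neq_ij]; first by rewrite coef0.
    by rewrite coefCM coef_coef_yderiv dqd // mulr0.
  case: (d) qd_neq0 => // d' qd_neq0 /=; rewrite coef_deriv => /mpolyP dq0.
  case/eqP: qd_neq0; apply/mpolyP => e; have := dq0 e.
  by rewrite mcoeffMn !mcoeff0 => /eqP; rewrite mulrn_eq0 => /eqP.
(* For d = 0 the lowest part of [q] is the restriction of [c] to the diagonal, in the variables
   y_ii. *)
case/eqP: qd_neq0; rewrite d0 -horner_coef0.
rewrite -[LHS]/(horner_eval 0 q) /q /offdiag_scale rmorph_mmap.
have : mmap (@mpolyC (n * n) C) (fun i => Y i i) (diag_restrict c) = 0 by rewrite c0 mmap0.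
rewrite /diag_restrict /comp_mpoly rmorph_mmap => c_diag0.
rewrite -[RHS]c_diag0; apply: eq_mmap => [a|k].
  by rewrite /= /horner_eval hornerC mmapC.
rewrite /= tnth_mktuple; case/mxvec_indexP: k => i j; rewrite !mxvecE !mxE /horner_eval.
rewrite hornerM hornerC; case: eqP => [->|_]; last by rewrite hornerX mulr0 mmap0.
by rewrite hornerC mulr1 mulr1n mmapX mmap1U mxE.
Qed.

End InvariantPolynomials.

(** * The isomorphism *)

Section WeightPoints.
Variables (C : numClosedFieldType) (n m : nat).
Local Notation K := {mpoly C[n]}.
Local Notation T := {mpoly K[m]}.
Implicit Types (p q : T) (F G : kirillov C n m).

Lemma size_m2s_symmon (b : 'I_(symdim n m)) : size (m2s (symmon b)) == m.
Proof. by rewrite size_m2s mdeg_symmon. Qed.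

(* The multiset of size m corresponding to a monomial of degree m. *)
Definition weight_pt (b : 'I_(symdim n m)) : m.-tuple 'I_n := Tuple (size_m2s_symmon b).

Lemma sum_weight_pt (V : nmodType) (g : 'I_n -> V) b :
  \sum_(j < m) g (tnth (weight_pt b) j) = \sum_i g i *+ symmon b i.
Proof.
rewrite -(big_tuple _ _ (weight_pt b) xpredT g) /= /m2s big_flatten big_map big_enum /=.
by apply: eq_bigr => i _; rewrite big_nseq iter_addr_0.
Qed.

(** A grid point is determined up to order by the multiset of its values. Symmetric polynomials
    therefore need to be tested at the weight points only. *)
Lemma weight_pt_perm (a : {ffun 'I_m -> 'I_n}) :
  exists b, exists s : 'S_m, forall j, a j = tnth (weight_pt b) (s j).
Proof.
pose e := s2m (codom_tuple a).
have deg_e : mdeg e = m.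
  rewrite mdegE (eq_bigr (fun i => count_mem i (codom_tuple a))) => [|i _]; last by rewrite mnmE.
  rewrite (eq_bigr (fun i => \sum_(j < m) (a j == i))%N) => [|i _]; last first.
    by rewrite -sum1_count big_map big_enum_cond /= big_mkcond.
  rewrite exchange_big -[RHS]card_ord -sum1_card; apply: eq_bigr => j _.
  by rewrite (bigD1 (a j)) //= eqxx big1 // => i; rewrite eq_sym => /negPf ->.
have lt_e : (mdeg e < m.+1)%N by rewrite deg_e.
have deg_e' : mdeg (BMultinom lt_e) == m by rewrite /= deg_e.
pose e' : symbasis n m := Sub (BMultinom lt_e) deg_e'.
exists (enum_rank e').
have symE : symmon (enum_rank e') = e by rewrite /symmon enum_rankK.
have /tuple_permP[s sE] : perm_eq (codom_tuple a) (weight_pt (enum_rank e')).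
  apply/allP => i _ /=; rewrite symE; apply/eqP.
  by have /mnmP/(_ i) := s2mK e; rewrite !mnmE => <-.
exists s => j; have := congr1 (fun t => nth (a j) t j) sE.
rewrite (nth_map j) ?size_enum_ord // nth_ord_enum => ->.
by rewrite -tnth_nth tnth_mktuple.
Qed.

Definition weight_eval b p : K := p.@[fun j => 'X_(tnth (weight_pt b) j)].

HB.instance Definition _ b := GRing.RMorphism.copy (weight_eval b)
  (meval (fun j => 'X_(tnth (weight_pt b) j) : K)).

Lemma msym_eval (s : 'S_m) (v : 'I_m -> K) p : (msym s p).@[v] = p.@[fun j => v (s j)].
Proof.
rewrite /meval /msym rmorph_mmap; apply: eq_mmap => [a|j] /=.
  exact: mmapC.
by rewrite mmapX mmap1U.
Qed.

Lemma symmetric_vanishing p : p \is symmetric -> (forall b, weight_eval b p = 0) ->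
  forall a : {ffun 'I_m -> 'I_n}, p.@[fun j => 'X_(a j)] = 0.
Proof.
move=> /issymP p_sym p0 a; have [b [s aE]] := weight_pt_perm a.
rewrite -(p0 b) /weight_eval -[in RHS](p_sym s) msym_eval.
by apply: meval_eq => j; rewrite aE.
Qed.

Definition restricts_to p F : Prop :=
  map_mx (@diag_restrict C n) (kirillov_map F) = diag_mx (\row_b weight_eval b p).

Lemma restricts_toD p q F G :
  restricts_to p F -> restricts_to q G -> restricts_to (p + q) (F + G).
Proof.
rewrite /restricts_to map_mxD => -> ->; rewrite -raddfD /=; congr diag_mx.
by apply/rowP => b; rewrite !mxE rmorphD.
Qed.

Lemma restricts_toB p q F G :
  restricts_to p F -> restricts_to q G -> restricts_to (p - q) (F - G).
Proof.
rewrite /restricts_to map_mxB => -> ->; rewrite -raddfB /=; congr diag_mx.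
by apply/rowP => b; rewrite !mxE rmorphB.
Qed.

Lemma restricts_toM p q F G :
  restricts_to p F -> restricts_to q G -> restricts_to (p * q) (F * G).
Proof.
rewrite /restricts_to -[kirillov_map (F * G)]/(kirillov_map F *m kirillov_map G) map_mxM.
move=> -> ->; rewrite mulmx_diag; congr diag_mx.
by apply/rowP => b; rewrite !mxE rmorphM.
Qed.

Lemma restricts_to_scalar c F : kirillov_map F = c%:M ->
  restricts_to (diag_restrict c)%:MP F.
Proof.
rewrite /restricts_to => ->; rewrite map_scalar_mx -diag_const_mx; congr diag_mx.
by apply/rowP => b; rewrite !mxE /weight_eval mevalC.
Qed.

Lemma GL_equivariantP F : GL_equivariant (kirillov_map F).
Proof. exact/asboolP/kirillovP. Qed.

(** The recursion of [gdiag] with t_i replaced by the variable u_j. *)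
Fixpoint gpoly k (j : 'I_m) : T :=
  if k is k'.+1 then (mesym n C k')%:MP - 'X_j * gpoly k' j else 0.

Definition gsum k : T := \sum_j gpoly k j.

Lemma weight_eval_gpoly b k j :
  weight_eval b (gpoly k j) = gdiag C k (tnth (weight_pt b) j).
Proof.
elim: k => [|k IH]; first by rewrite [LHS]rmorph0.
by rewrite /= rmorphB rmorphM /= IH /weight_eval mevalC mevalXU.
Qed.

Lemma diag_restrict_pi_cgrad k :
  map_mx (@diag_restrict C n) (pi_map m (cgrad C n k))
  = diag_mx (\row_b weight_eval b (gsum k)).
Proof.
rewrite (diag_restrict_pi_map m (diag_restrict_cgrad C n k)); congr diag_mx.
apply/rowP => b; rewrite !mxE -sum_weight_pt rmorph_sum.
by apply: eq_bigr => j _; rewrite -weight_eval_gpoly.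
Qed.

Lemma tupoly_C (c : K) : c \is symmetric -> c%:MP \in @tupoly_pred C n m.
Proof.
move=> c_sym; apply/andP; split; first by rewrite mpolyOverC.
by apply/issymP => s; rewrite /msym mmapC.
Qed.

Lemma gsum_tupoly k : gsum k \in @tupoly_pred C n m.
Proof.
apply/andP; split.
  apply: rpred_sum => j _; elim: k => [|k IH]; first exact: rpred0.
  apply: rpredB; first by rewrite mpolyOverC mesym_sym.
  by apply: rpredM => //; exact: mpolyOverX.
apply/issymP => s; rewrite /gsum raddf_sum [RHS](reindex_perm s) /=.
apply: eq_bigr => j _; elim: k => [|k IH]; first by rewrite rmorph0.
by rewrite /= rmorphB rmorphM /= IH msymXU /msym mmapC.
Qed.

Lemma big_restricts F : big_generated F -> exists p : tupoly C n m, restricts_to (tupoly_poly p) F.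
Proof.
elim=> {F} [a F FE|p q F le_pq FE|F G _ [p pF] _ [q qG]|F G _ [p pF] _ [q qG]].
- have aT : (a%:MP : K)%:MP \in @tupoly_pred C n m by apply/tupoly_C; rewrite -alg_mpolyC rpredZ ?rpred1.
  exists (TUPoly aT) => /=; have := restricts_to_scalar FE.
  by rewrite /diag_restrict comp_mpolyC.
- case: q => [|q] in le_pq FE *.
    exists (TUPoly (tupoly_C (mesym_sym n C (p + 0)))) => /=.
    by rewrite -diag_restrict_cpoly; apply: restricts_to_scalar.
  have [c cE] := iter_kirillov_wei_cpoly C n m p q.
  have cT : (c%:MP : K)%:MP * gsum p.+1 \in @tupoly_pred C n m.
    case: (tupoly_subring C n m) => _ _; apply; last exact: gsum_tupoly.
    by apply/tupoly_C; rewrite -alg_mpolyC rpredZ ?rpred1.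
  exists (TUPoly cT); rewrite /restricts_to FE cE map_mxZ diag_restrict_pi_cgrad /=.
  rewrite [diag_restrict _]comp_mpolyC -[LHS]linearZ /=; congr diag_mx.
  by apply/rowP => b; rewrite !mxE rmorphM /= [weight_eval _ _%:MP]mevalC.
- by exists (p + q); exact: restricts_toD.
- by exists (p * q); exact: restricts_toM.
Qed.

Definition big_realized p : Prop := exists2 F, big_generated F & restricts_to p F.

Lemma scalar_kirillov (a : C) : a%:MP%:M \in @kirillov_pred C n m.
Proof.
apply/asboolP => g X g_unit; rewrite /polymap_eval !map_scalar_mx /= /glpoly_eval.
by rewrite mul_mx_scalar -scalemxAl -rho_mul mulmxV // rho1 scalemx1 !mevalC.
Qed.

Lemma big_realizedC (a : C) : big_realized (a%:MP%:MP).
Proof.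
exists (Kirillov (scalar_kirillov a)); first exact: BigConst.
have := @restricts_to_scalar a%:MP (Kirillov (scalar_kirillov a)) erefl.
by rewrite /diag_restrict comp_mpolyC.
Qed.

Lemma big_realizedD p q : big_realized p -> big_realized q -> big_realized (p + q).
Proof.
move=> [F Fb Fp] [G Gb Gq]; exists (F + G); first exact: BigAdd.
exact: restricts_toD.
Qed.

Lemma big_realizedM p q : big_realized p -> big_realized q -> big_realized (p * q).
Proof.
move=> [F Fb Fp] [G Gb Gq]; exists (F * G); first exact: BigMul.
exact: restricts_toM.
Qed.

Lemma big_realizedB p q : big_realized p -> big_realized q -> big_realized (p - q).
Proof.
move=> pB qB; have -> : p - q = p + ((-1)%:MP : K)%:MP * q.
  by rewrite mpolyCN mpolyC1 mpolyCN mpolyC1 mulN1r.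
by apply: big_realizedD => //; apply: big_realizedM => //; exact: big_realizedC.
Qed.

Lemma big_realized0 : big_realized 0.
Proof. by rewrite -mpolyC0 -mpolyC0; exact: big_realizedC. Qed.

Lemma big_realized_sum (I : Type) (r : seq I) (f : I -> T) :
  (forall i, big_realized (f i)) -> big_realized (\sum_(i <- r) f i).
Proof.
move=> fB; elim/big_rec: _ => [|i x _ xB]; first exact: big_realized0.
exact: big_realizedD.
Qed.

Lemma big_realizedX p k : big_realized p -> big_realized (p ^+ k).
Proof.
move=> pB; elim: k => [|k IH]; last by rewrite exprS; exact: big_realizedM.
by rewrite expr0 -mpolyC1 -mpolyC1; exact: big_realizedC.
Qed.

Lemma big_realized_div p k : big_realized (p *+ k.+1) -> big_realized p.
Proof.
move=> pB; have -> : p = ((k.+1%:R^-1)%:MP : K)%:MP * (p *+ k.+1).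
  rewrite mulrnAr -mulrnAl -!mpolyCMn -[_^-1 *+ _]mulr_natr mulVf ?pnatr_eq0 //.
  by rewrite !mpolyC1 mul1r.
by apply: big_realizedM => //; exact: big_realizedC.
Qed.

(** The invariant [c] itself is recorded besides its restriction: this serves to identify the action
    of invariant polynomials on the big algebra. *)
Definition scalar_realized (d : K) : Prop :=
  exists c : {mpoly C[n * n]}, [/\ gl_invariant c, diag_restrict c = d
    & exists2 F : kirillov C n m, big_generated F & kirillov_map F = c%:M].

Lemma scalar_realizedC (a : C) : scalar_realized a%:MP.
Proof.
exists a%:MP; split; last by exists (Kirillov (scalar_kirillov a)) => //; exact: BigConst.
  by move=> X; rewrite /gl_act big1 // => i _; rewrite big1 // => j _; rewrite yderivC mul0r.
exact: comp_mpolyC.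
Qed.

Lemma scalar_realizedD d e : scalar_realized d -> scalar_realized e -> scalar_realized (d + e).
Proof.
move=> [c [c_inv <- [F Fb Fc]]] [c' [c'_inv <- [G Gb Gc]]]; exists (c + c').
split; last by exists (F + G); [exact: BigAdd | rewrite raddfD /= -Fc -Gc].
  by move=> X; rewrite -[c]scale1r gl_act_is_linear c_inv c'_inv scaler0 addr0.
by rewrite rmorphD.
Qed.

Lemma scalar_realizedM d e : scalar_realized d -> scalar_realized e -> scalar_realized (d * e).
Proof.
move=> [c [c_inv <- [F Fb Fc]]] [c' [c'_inv <- [G Gb Gc]]]; exists (c * c').
split; last first.
  by exists (F * G); [exact: BigMul | rewrite scalar_mxM -Fc -Gc].
  by rewrite rmorphM.
by move=> X; rewrite gl_actM c_inv c'_inv mul0r mulr0 addr0.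
Qed.

Lemma scalar_realizedX d k : scalar_realized d -> scalar_realized (d ^+ k).
Proof.
move=> dB; elim: k => [|k IH]; last by rewrite exprS; exact: scalar_realizedM.
by rewrite expr0 -mpolyC1; exact: scalar_realizedC.
Qed.

Lemma scalar_realized_mesym k : scalar_realized (mesym n C k).
Proof.
have [lt_nk|le_kn] := ltnP n k.
  by rewrite mesym_geqnE // -mpolyC0; exact: scalar_realizedC.
have kP : (cpoly C n k)%:M \in @kirillov_pred C n m by apply/asboolP/GL_equivariant_cpoly.
exists (cpoly C n k); split; [exact: cpoly_gl_invariant | exact: diag_restrict_cpoly |].
by exists (Kirillov kP) => //; apply: (@BigGen _ _ _ k 0); rewrite ?addn0.
Qed.

Lemma scalar_realized_symmetric d : d \is symmetric -> scalar_realized d.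
Proof.
move=> /sym_fundamental[q [<- _]]; rewrite comp_mpolyEX.
elim/big_rec: _ => [|a x _ xB]; first by rewrite -mpolyC0; exact: scalar_realizedC.
apply: scalar_realizedD => //; rewrite -mul_mpolyC.
apply: scalar_realizedM; first exact: scalar_realizedC.
rewrite comp_mpolyX; elim/big_rec: _ => [|i y _ yB].
  by rewrite -mpolyC1; exact: scalar_realizedC.
apply: scalar_realizedM => //; apply: scalar_realizedX.
by rewrite tnth_mktuple; exact: scalar_realized_mesym.
Qed.

Lemma big_realized_symmetricC (d : K) : d \is symmetric -> big_realized d%:MP.
Proof.
move=> /scalar_realized_symmetric[c [_ <- [F Fb Fc]]].
by exists F => //; exact: restricts_to_scalar.
Qed.

Lemma big_realized_gsum k : big_realized (gsum k.+1).
Proof.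
(* For k >= n the gradient [cgrad k.+1] is 0, so [gsum k.+1] vanishes at all the weight points and
   is realized by 0. *)
have [lt_nk|lt_kn] := leqP n k.
  have [F Fb F0] := big_realized0; exists F => //; rewrite /restricts_to F0.
  rewrite -diag_restrict_pi_cgrad cgrad_gt // pi_map0 map_mx0.
  by apply/matrixP => r s; rewrite !mxE rmorph0 mul0rn.
have kP : pi_map m (cgrad C n k.+1) \in @kirillov_pred C n m.
  exact/asboolP/GL_equivariant_pi_cgrad.
exists (Kirillov kP); last exact: diag_restrict_pi_cgrad.
by apply: (@BigGen _ _ _ k 1); rewrite addn1 //= kirillov_wei_cpoly.
Qed.

Lemma gsum_psum k :
  gsum k = \sum_(i < k) ((-1) ^+ i * (mesym n C (k - i.+1))%:MP) * psum K m i.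
Proof.
have gpolyE j : gpoly k j = \sum_(i < k) ((-1) ^+ i * (mesym n C (k - i.+1))%:MP) * 'X_j ^+ i.
  elim: k => [|k IH]; first by rewrite big_ord0.
  rewrite big_ord_recl /= IH expr0 mul1r mulr1 subn1 /=; congr (_ + _).
  rewrite mulr_sumr -sumrN; apply: eq_bigr => i _.
  by rewrite /bump /= add1n subSS !exprS; ring.
rewrite /gsum (eq_bigr _ (fun j _ => gpolyE j)) exchange_big.
by apply: eq_bigr => i _; rewrite mulr_sumr.
Qed.

(** In [gsum k.+1] the power sum of exponent [k] has coefficient (-1)^k, as e_0 = 1; the remaining
    terms involve smaller exponents and symmetric coefficients. *)
Lemma big_realized_psum k : big_realized (psum K m k).
Proof.
elim/ltn_ind: k => k IH.
have sgnB i : big_realized ((-1) ^+ i).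
  apply: big_realizedX; have := big_realizedC (-1).
  by rewrite mpolyCN mpolyC1 mpolyCN mpolyC1.
have := gsum_psum k.+1; rewrite big_ord_recr /= subnn mesym0E mpolyC1 mulr1.
set R := \sum_(i < k) _ => gE.
have -> : psum K m k = (-1) ^+ k * (gsum k.+1 - R).
  by rewrite gE [R + _]addrC addrK mulrA -exprD addnn -mul2n exprM sqrrN expr1n expr1n mul1r.
apply: big_realizedM => //; apply: big_realizedB; first exact: big_realized_gsum.
apply: big_realized_sum => i; apply: big_realizedM; last exact: IH.
by apply: big_realizedM => //; exact/big_realized_symmetricC/mesym_sym.
Qed.

End WeightPoints.

(** Up to the factor m.+1!, [p] is a combination of symmetrized monomials, which power sums generate
    by the induction on monomials, now with weight 1 and an arbitrary distinguished variable. *)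
Lemma tupoly_realized (C : numClosedFieldType) (n m : nat) (p : tupoly C n m.+1) :
  big_realized (tupoly_poly p).
Proof.
case: p => p /= /andP[p_t p_u]; set P := @big_realized C n m.+1.
have Pdiv k (x : {mpoly {mpoly C[n]}[m.+1]}) : P (x *+ k.+1) -> P x by exact: big_realized_div.
apply: (Pdiv (m.+1)`!.-1); rewrite prednK ?fact_gt0 // -symz_symmetric //.
rewrite {1}[p]mpolyE raddf_sum; apply: big_realized_sum => a /=.
rewrite symzZ -mul_mpolyC; apply: big_realizedM.
  by apply: big_realized_symmetricC; exact: (mpolyOverP _ p_t).
rewrite -['X_[a]]mul1r; apply: (symz_monomial_ind (i0 := ord0) (P := P)) => //.
- by move=> s _; rewrite rmorph1.
- exact: big_realizedB.
- by move=> b x xP; apply: big_realizedM => //; exact: big_realized_psum.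
move=> b; rewrite mul1r; apply: (Pdiv m).
rewrite (symz_orbit (F := fun j => 'X_j ^+ b)) => [|s j]; last by rewrite rmorphXn /= msymXU.
rewrite -(prednK (fact_gt0 m.+1)) -mulr_natl -mpolyC_nat -mpolyC_nat.
by apply: big_realizedM; [exact: big_realizedC | exact: big_realized_psum].
Qed.

(** * Construction of the isomorphism from the matching relation *)

Section Isomorphism.
Variables (C : numClosedFieldType) (n m : nat).
Local Notation Tu := (tupoly C n.+1 m.+1).
Local Notation Big := (big_algebra C n.+1 m.+1).
Local Notation Q := {ideal_quot @Jideal C n.+1 m.+1}.
Implicit Types (p q : Tu) (F G : Big).

Definition matches p F := restricts_to (tupoly_poly p) (big_kirillov F).

Lemma matchesB p q F G : matches p F -> matches q G -> matches (p - q) (F - G).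
Proof. exact: restricts_toB. Qed.

Lemma matchesM p q F G : matches p F -> matches q G -> matches (p * q) (F * G).
Proof. exact: restricts_toM. Qed.

Lemma matches1 : matches 1 1.
Proof.
have := @restricts_to_scalar C n.+1 m.+1 1 1 erefl.
by rewrite /matches /= rmorph1 mpolyC1.
Qed.

(** If F = 0, then [p] vanishes at the weight points, hence on the whole grid, hence lies in J.
    Conversely each f_i vanishes on the grid, so a member of J forces a zero restriction, and F = 0
    by equivariance. *)
Lemma matches_Jideal p F : matches p F -> F = 0 <-> p \in @Jideal C n.+1 m.+1.
Proof.
move=> pF; have {}pF : map_mx (@diag_restrict C n.+1) (kirillov_map (big_kirillov F))
  = diag_mx (\row_b weight_eval b (tupoly_poly p)) by exact: pF.
split=> [F0|/asboolP[a pE]].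
  apply: tupoly_vanishing; apply: symmetric_vanishing.
    by have /andP[] := tupolyP p.
  move=> b; move: pF; rewrite F0 map_mx0 => /matrixP/(_ b b).
  by rewrite !mxE eqxx mulr1n.
do 2![apply: val_inj]; apply: GL_equivariant_vanishing; first exact: GL_equivariantP.
rewrite [LHS]pF; apply/matrixP => b b'; rewrite !mxE.
rewrite (_ : weight_eval b _ = 0) ?mul0rn // pE.
rewrite (big_morph (@tupoly_poly C n.+1 m.+1) (id1 := 0) (op1 := +%R)) //.
rewrite rmorph_sum big1 // => k _ /=; rewrite rmorphM /=.
rewrite [X in _ * X](_ : _ = 0) ?mulr0 // /jpoly rmorph_sum big1 // => i _ /=.
rewrite rmorphM /= [X in _ * X](_ : _ = 0) ?mulr0 // /fpoly rmorph_prod /=.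
rewrite (bigD1 (tnth (weight_pt b) i)) //= rmorphB /=.
by rewrite {1 2}/weight_eval mevalXU mevalC subrr mul0r.
Qed.

Lemma matches_fun p q F G : matches p F -> matches q G ->
  F = G <-> \pi_Q%qT p = \pi_Q%qT q.
Proof.
move=> pF qG; have [FG GF] := matches_Jideal (matchesB pF qG).
split=> [eqFG|/eqP].
  by apply/eqP; rewrite -Quotient.idealrBE FG // eqFG subrr.
by rewrite -Quotient.idealrBE => /GF /eqP; rewrite subr_eq0 => /eqP.
Qed.

Lemma exists_match p : exists F, matches p F.
Proof.
have [F Fb pF] := tupoly_realized p.
by exists (BigAlgebra (asboolT Fb)).
Qed.

Lemma matched F : exists p, matches p F.
Proof. by case: F => F /= F_big; apply: big_restricts; exact/asboolP. Qed.

(** A chosen match of a chosen representative; by [matches_fun] the result is independent of both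
    choices. *)
Definition quot_to_big (x : Q) : Big := projT1 (cid (exists_match (generic_quotient.repr x))).

Definition big_to_quot F : Q := \pi_Q%qT (projT1 (cid (matched F))).

Lemma quot_to_big_matches x : matches (generic_quotient.repr x) (quot_to_big x).
Proof. exact: projT2 (cid (exists_match (generic_quotient.repr x))). Qed.

Lemma quot_to_bigE p F : matches p F -> quot_to_big (\pi_Q%qT p) = F.
Proof. by move=> pF; apply/(matches_fun (quot_to_big_matches _) pF); rewrite reprK. Qed.

Lemma quot_to_big_is_zmod_morphism : zmod_morphism quot_to_big.
Proof.
move=> x y; rewrite -{1}[x]reprK -{1}[y]reprK -rmorphB.
by apply: quot_to_bigE; apply: matchesB; exact: quot_to_big_matches.
Qed.

Lemma quot_to_big_is_monoid_morphism : monoid_morphism quot_to_big.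
Proof.
split=> [|x y].
  by rewrite -(rmorph1 \pi_Q%qT); apply: quot_to_bigE; exact: matches1.
rewrite -{1}[x]reprK -{1}[y]reprK -rmorphM.
by apply: quot_to_bigE; apply: matchesM; exact: quot_to_big_matches.
Qed.

HB.instance Definition _ :=
  GRing.isZmodMorphism.Build Q Big quot_to_big quot_to_big_is_zmod_morphism.
HB.instance Definition _ :=
  GRing.isMonoidMorphism.Build Q Big quot_to_big quot_to_big_is_monoid_morphism.

Lemma quot_to_big_bij : bijective quot_to_big.
Proof.
exists big_to_quot => [x|F].
  rewrite -[RHS]reprK /big_to_quot; case: cid => p pF /=.
  by apply/(matches_fun pF (quot_to_big_matches _)).
rewrite /big_to_quot; case: cid => p pF /=; exact: quot_to_bigE.
Qed.

(** The restriction of [c] is symmetric, so it lifts to an invariant [c'] whose scalar map lies in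
    the big algebra; injectivity of restriction on invariants gives c = c'. *)
Lemma quot_to_big_base (c : glinv C n.+1) :
  kirillov_map (big_kirillov (quot_to_big (\pi_Q%qT (tupoly_base m.+1 c)))) = (glinv_poly c)%:M.
Proof.
have c_inv : gl_invariant (glinv_poly c) by have /asboolP := glinvP c.
have d_sym : diag_restrict (glinv_poly c) \is symmetric.
  by apply/issymP => s; apply: msym_diag_restrict.
have [c' [c'_inv c'd [F Fb Fc']]] := scalar_realized_symmetric m.+1 d_sym.
have -> : glinv_poly c = c'.
  apply/eqP; rewrite -subr_eq0; apply/eqP; apply: gl_invariant_vanishing.
    move=> X; rewrite addrC -scaleN1r gl_act_is_linear c_inv c'_inv scaler0 addr0 //.
  by rewrite rmorphB /= c'd subrr.
rewrite (@quot_to_bigE _ (BigAlgebra (asboolT Fb))) //=.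
by rewrite /matches /= -c'd; exact: restricts_to_scalar.
Qed.

End Isomorphism.

Theorem theorem8p17 (R : realType) (n m : nat) :
  let C := R[i] in
  let Q := {ideal_quot @Jideal C n.+1 m.+1} in
  exists phi : {rmorphism Q -> big_algebra C n.+1 m.+1},
    bijective phi /\
    forall (c : glinv C n.+1) (x : Q),
      kirillov_map (big_kirillov (phi (\pi_Q%qT (tupoly_base m.+1 c) * x)))
      = glinv_poly c *: kirillov_map (big_kirillov (phi x)).
Proof.
move=> C Q; exists (@quot_to_big C n m); split; first exact: quot_to_big_bij.
move=> c x; rewrite rmorphM -mul_scalar_mx -quot_to_big_base.
by [].
Qed.
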